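(* Let $\beta$ be the distribution on $\{0,1\}$ with $\beta(0)=1/4$, $\beta(1)=3/4$, and let $g:\{0,1\}^*\to\{0,1\}^*$. If $\dim^g_{\mathrm{p},\beta}(\mathrm{NP})<1$, then $\dim^g_{\mathrm{p},\gamma_0}(\mathrm{disjNP})<1$, where $\gamma_0$ is the distribution on $\{0,1,-1\}$ with $\gamma_0(0)=1/4$, $\gamma_0(1)=\gamma_0(-1)=3/8$.
   Context: Let $s_0,s_1,\dots$ be the length-lexicographic enumeration of $\{0,1\}^*$. A language $A$ is identified with the sequence over $\{0,1\}$ whose $n$-th symbol is $1$ iff $s_n\in A$. A disjoint pair $(A,B)$ ($A\cap B=\emptyset$) is identified with the sequence over $\{0,1,-1\}$ whose $n$-th symbol is $1$ if $s_n\in A$, $-1$ if $s_n\in B$, $0$ otherwise; $\mathrm{disjNP}$ is the set of disjoint pairs $(A,B)$ with $A,B\in\mathrm{NP}$. $\mathrm{p}^g$ is the class of functions computable in polynomial time with oracle access to the function $g$. For a finite alphabet $\Sigma$, a distribution $\delta$ on $\Sigma$ and $s\ge0$, a $\delta$-$s$-gale is $d:\Sigma^*\to[0,\infty)$ with $d(w)=\sum_{a\in\Sigma}d(wa)\delta(a)^s$; it succeeds on a sequence $S$ if $\limsup_n d(S\upharpoonright n)=\infty$. $d$ is $\mathrm{p}^g$-computable if some $\hat d\in\mathrm{p}^g$ satisfies $|\hat d(w,r)-d(w)|\le2^{-r}$ (rational output, $r$ in unary). $\dim^g_{\mathrm{p},\delta}(X)$ is the infimum of $s$ such that some $\mathrm{p}^g$-computable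 $\delta$-$s$-gale succeeds on every member of $X$. *)

(* Defs.v *)
From mathcomp Require Import all_boot all_order all_algebra.
From mathcomp Require Import all_classical all_reals all_analysis.
From mathcomp Require Import lra.

Set Implicit Arguments.
Unset Strict Implicit.
Unset Printing Implicit Defensive.

Import Order.TTheory GRing.Theory Num.Theory.

Local Open Scope classical_set_scope.
Local Open Scope ring_scope.

(* Polynomial time is time on an oracle multi-stack machine with structured    *)
(* control.  A work tape of a Turing machine is a pair of stacks, so time on   *)
(* these programs and on multitape oracle Turing machines agree up to a        *)
(* constant factor.  As for Turing machines, the query tape is write-only, the *)
(* answer tape is read-only, and a query is one step whatever the length of    *)
(* the answer.                                                                 *)
Inductive stack := Work of nat | Answer.

Inductive prog :=
  | Skip
  | Push of bool & nat
  | Pop of stack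
  | Write of bool
  | Ask
  | Seq of prog & prog
  | Case of stack & prog & prog & prog (* top: none, false, true *)
  | While of stack & prog.             (* loop until the stack is empty *)

Record state := State {
  work : nat -> seq bool;
  query : seq bool;
  answer : seq bool
}.

Definition contents (u : state) (s : stack) : seq bool :=
  match s with Work i => work u i | Answer => answer u end.

Definition push (b : bool) (i : nat) (u : state) : state :=
  State [eta work u with i |-> b :: work u i] (query u) (answer u).

Definition pop (s : stack) (u : state) : state :=
  match s with
  | Work i =>
      State [eta work u with i |-> behead (work u i)] (query u) (answer u)
  | Answer => State (work u) (query u) (behead (answer u))
  end.

Definition write (b : bool) (u : state) : state :=
  State (work u) (rcons (query u) b) (answer u).

Definition ask (g : seq bool -> seq bool) (u : state) : state :=
  State (work u) [::] (g (query u)).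

Definition branch (v : seq bool) (p0 p1 p2 : prog) : prog :=
  match v with [::] => p0 | false :: _ => p1 | true :: _ => p2 end.

(* [exec g p u t v]: with oracle [g], [p] started in [u] halts in [v] after    *)
(* exactly [t] steps.                                                          *)
Inductive exec (g : seq bool -> seq bool) :
    prog -> state -> nat -> state -> Prop :=
  | ExecSkip u : exec g Skip u 1 u
  | ExecPush b i u : exec g (Push b i) u 1 (push b i u)
  | ExecPop s u : exec g (Pop s) u 1 (pop s u)
  | ExecWrite b u : exec g (Write b) u 1 (write b u)
  | ExecAsk u : exec g Ask u 1 (ask g u)
  | ExecSeq p q u v w t t' :
      exec g p u t v -> exec g q v t' w -> exec g (Seq p q) u (t + t') w
  | ExecCase s p0 p1 p2 u t v :
      exec g (branch (contents u s) p0 p1 p2) u t v ->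
      exec g (Case s p0 p1 p2) u t.+1 v
  | ExecWhileStop s p u :
      contents u s = [::] -> exec g (While s p) u 1 u
  | ExecWhileStep s p u v w t t' :
      contents u s <> [::] -> exec g p u t v -> exec g (While s p) v t' w ->
      exec g (While s p) u (t + t').+1 w.

Definition init (xs : seq (seq bool)) : state :=
  State (nth [::] xs) [::] [::].

(* [polytime g enc rep f]: [f] is in p^g, where [enc x] lists the strings      *)
(* encoding the input [x] (one per stack) and [rep y v] says that the final    *)
(* stacks [v] represent the output [y].                                        *)
Definition polytime (g : seq bool -> seq bool) (X Y : Type)
    (enc : X -> seq (seq bool)) (rep : Y -> (nat -> seq bool) -> Prop)
    (f : X -> Y) : Prop :=
  exists (p : prog) (k : nat), forall x : X, exists (t : nat) (v : state),
    [/\ exec g p (init (enc x)) t v,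
        (t <= sumn (map size (enc x)) ^ k + k)%N
      & rep (f x) (work v)].

Definition no_oracle : seq bool -> seq bool := fun=> [::].

Definition enc_strings (xy : seq bool * seq bool) : seq (seq bool) :=
  [:: xy.1; xy.2].

Definition rep_bool (b : bool) (v : nat -> seq bool) : Prop := v 0%N = [:: b].

Definition NP : set (set (seq bool)) :=
  [set A | exists (V : seq bool * seq bool -> bool) (k : nat),
     polytime no_oracle enc_strings rep_bool V /\
     forall x, A x <->
       exists y, (size y <= size x ^ k + k)%N /\ V (x, y)].

Definition disjNP : set (set (seq bool) * set (seq bool)) :=
  [set AB | [/\ NP AB.1, NP AB.2 & AB.1 `&` AB.2 = set0]].

(* Successor in the length-lexicographic order, on reversed strings.           *)
Fixpoint lenlex_succ (w : seq bool) : seq bool :=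
  match w with
  | [::] => [:: false]
  | false :: w' => true :: w'
  | true :: w' => false :: lenlex_succ w'
  end.

Definition lenlex (n : nat) : seq bool := rev (iter n lenlex_succ [::]).

Definition lang_seq (A : set (seq bool)) : nat -> bool :=
  fun n => `[< A (lenlex n) >].

(* The alphabet {0, 1, -1} is [option bool]: 0 is [None], 1 is [Some true] and *)
(* -1 is [Some false].                                                         *)
Definition pair_seq (AB : set (seq bool) * set (seq bool)) :
    nat -> option bool :=
  fun n => if `[< AB.1 (lenlex n) >] then Some true
           else if `[< AB.2 (lenlex n) >] then Some false
           else None.

(* A word over [Sigma] is presented as a bit string by replacing its i-th      *)
(* symbol by the codeword 1^i 0.                                               *)
Definition enc_word (Sigma : finType) (w : seq Sigma) : seq bool :=
  flatten [seq rcons (nseq (enum_rank a) true) false | a <- w].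

Definition enc_word_unary (Sigma : finType) (wr : seq Sigma * nat) :
    seq (seq bool) :=
  [:: enc_word wr.1; nseq wr.2 true].

(* Binary value, least significant bit first.                                  *)
Fixpoint nat_of_bits (w : seq bool) : nat :=
  if w is b :: w' then (b + (nat_of_bits w').*2)%N else 0%N.

(* A rational is output as sign, numerator and denominator on three stacks,    *)
(* not necessarily in lowest terms.                                            *)
Definition rep_rat (q : rat) (v : nat -> seq bool) : Prop :=
  exists sgn : bool,
    [/\ v 0%N = [:: sgn], (0 < nat_of_bits (v 2%N))%N
      & q = (-1) ^+ sgn * (nat_of_bits (v 1%N))%:R / (nat_of_bits (v 2%N))%:R].

Record distr (R : realType) (Sigma : finType) := Distr {
  distr_fun :> Sigma -> R;
  distr_ge0 : forall a, 0 <= distr_fun a;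
  distr_sum1 : \sum_a distr_fun a = 1
}.

Definition gale (R : realType) (Sigma : finType) (delta : distr R Sigma)
    (s : R) (d : seq Sigma -> R) : Prop :=
  (forall w, 0 <= d w) /\
  (forall w, d w = \sum_a d (rcons w a) * delta a `^ s).

Definition succeeds (R : realType) (Sigma : finType) (d : seq Sigma -> R)
    (S : nat -> Sigma) : Prop :=
  limn_esup (fun n => (d (mkseq S n))%:E) = +oo%E.

Definition pcomputable (R : realType) (Sigma : finType)
    (g : seq bool -> seq bool) (d : seq Sigma -> R) : Prop :=
  exists dhat : seq Sigma * nat -> rat,
    polytime g (@enc_word_unary Sigma) rep_rat dhat /\
    forall w r, `|ratr (dhat (w, r)) - d w| <= 2 ^- r.

Definition pdim (R : realType) (Sigma : finType) (g : seq bool -> seq bool)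
    (delta : distr R Sigma) (X : set (nat -> Sigma)) : \bar R :=
  ereal_inf [set s%:E | s in [set s : R | 0 <= s /\
    exists d : seq Sigma -> R,
      [/\ gale delta s d, pcomputable g d & forall S, X S -> succeeds d S]]].

Definition beta_mass (R : realType) (a : bool) : R :=
  if a then 3 / 4 else 1 / 4.

Lemma beta_mass_ge0 (R : realType) (a : bool) : 0 <= beta_mass R a.
Proof. by case: a; rewrite divr_ge0. Qed.

Lemma beta_mass_sum1 (R : realType) : \sum_a beta_mass R a = 1.
Proof. by rewrite big_bool /beta_mass /=; lra. Qed.

Definition beta_distr (R : realType) : distr R bool :=
  Distr (@beta_mass_ge0 R) (beta_mass_sum1 R).

Definition gamma0_mass (R : realType) (a : option bool) : R :=
  if a is Some _ then 3 / 8 else 1 / 4.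

Lemma gamma0_mass_ge0 (R : realType) (a : option bool) : 0 <= gamma0_mass R a.
Proof. by case: a => [a|]; rewrite divr_ge0. Qed.

Lemma gamma0_mass_sum1 (R : realType) : \sum_a gamma0_mass R a = 1.
Proof.
rewrite (bigD1 None) //= (reindex_omap Some id) => [|[]//].
rewrite (eq_bigl xpredT) => [|a]; last by rewrite eqxx.
by rewrite big_bool /gamma0_mass /=; lra.
Qed.

Definition gamma0_distr (R : realType) : distr R (option bool) :=
  Distr (@gamma0_mass_ge0 R) (gamma0_mass_sum1 R).

(* Main.v *)
(* From a gale d for the biased coin, put d'(w) = d(|w|) A^a B^b, where |w|    *)
(* replaces both nonzero letters by 1, and a, b count the zero and the nonzero *)
(* letters of w.  For s' close to 1, suitable A, B >= 1 make d' a gamma_0-s'-  *)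
(* gale, and d' >= d(|.|) succeeds on (C, D) because d succeeds on the NP      *)
(* language C u D.                                                             *)
(*   The point is that d' is p^g-computable although s is an arbitrary real:   *)
(* (1/4)^s and (3/4)^s solve the two linear equations that the gale condition  *)
(* gives at two suitable nodes of d, so they are quotients of values of d; and *)
(* for s' = 1 - 1/k the other factors of A and B are k-th roots of rationals.  *)
(* Suitable nodes exist because otherwise d would place the same relative bets *)
(* everywhere, and could not win both on the empty language and on the full    *)
(* one, as (1/4)^s + (3/4)^s >= 1.                                             *)
Require Import Defs.
From mathcomp Require Import all_boot all_order all_algebra.
From mathcomp Require Import all_classical all_reals all_analysis.
From mathcomp Require Import zify ring lra.

Set Implicit Arguments.
Unset Strict Implicit.
Unset Printing Implicit Defensive.

Import Order.TTheory GRing.Theory Num.Theory.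

(** * Programs *)

Local Open Scope nat_scope.

(** At exponent s' = 1 the factors demanded by [gale_lift] would be A = 4^(1-s) and B = (4/3)^(1-s),
    since the masses of 1 and -1 add up to the mass of 1 under the biased coin. Both exceed 1
    because s < 1, so by continuity they stay at least 1 for some s' < 1; [lift_exponent] makes this
    quantitative with s' = 1 - 1/k. The lifted gale treats 1 and -1 alike, hence bets on the union
    of the pair, which is in NP by [NP_union]; [lift_succeeds] transfers success.

    It remains to compute the lifted gale ([apx_lift_gale]). The exponent s is an arbitrary real,
    but a computable d determines what is needed: [beta_gale_independent] yields two words at which
    the gale equations are independent, and Cramer's rule expresses (1/4)^s and (3/4)^s by finitely
    many values of d. These words are fixed, so they are built into the program.

    Most of the development carries this computation out on the machine model. [fp] is a class of
    string functions closed under composition ([fp_let]), size-bounded recursion on notation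
    ([fp_rec]) and calls of given programs ([fp_call]); binary arithmetic and bisection are written
    in it. On top, [apx] collects nonnegative real functions with approximations to any unary
    precision, together with the arithmetic that the lifted gale uses. [apx_pcomputable] and
    [pcomputable_apx] connect it with [pcomputable]. *)

Lemma leq_expn (m n k : nat) : m <= n -> m ^ k <= n ^ k.
Proof. by case: k => // k mn; rewrite leq_exp2r. Qed.

(** The base is at least 2, so constants and sums are absorbed by a larger exponent and one number
    [k] describes the bound; [exp_of_polybounded] returns to the form used in [polytime]. *)
Definition polybounded (X : Type) (s f : X -> nat) : Prop :=
  exists k, forall x, f x <= (s x + 2) ^ k.

Lemma polybounded_le (X : Type) (s f h : X -> nat) :
  (forall x, f x <= h x) -> polybounded s h -> polybounded s f.
Proof. by move=> fh [k hk]; exists k => x; exact: leq_trans (fh x) (hk x). Qed.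

Lemma polybounded_cst (X : Type) (s : X -> nat) c : polybounded s (fun=> c).
Proof.
exists c => x; apply: leq_trans (ltnW (ltn_expl c (isT : 1 < 2))) _.
exact/leq_expn/leq_addl.
Qed.

Lemma polybounded_size (X : Type) (s : X -> nat) : polybounded s s.
Proof. by exists 1 => x; rewrite expn1 leq_addr. Qed.

Lemma polybounded_add (X : Type) (s f h : X -> nat) :
  polybounded s f -> polybounded s h -> polybounded s (fun x => f x + h x).
Proof.
move=> [k fk] [l hl]; exists (k + l + 1) => x.
have s2 : 0 < s x + 2 by rewrite addn2.
have e1 : (s x + 2) ^ k <= (s x + 2) ^ (k + l) by rewrite leq_pexp2l ?leq_addr.
have e2 : (s x + 2) ^ l <= (s x + 2) ^ (k + l) by rewrite leq_pexp2l ?leq_addl.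
rewrite expnD expn1; move: (fk x) (hl x) e1 e2.
set a := (_ + _) ^ (k + l); nia.
Qed.

Lemma polybounded_mul (X : Type) (s f h : X -> nat) :
  polybounded s f -> polybounded s h -> polybounded s (fun x => f x * h x).
Proof.
by move=> [k fk] [l hl]; exists (k + l) => x; rewrite expnD leq_mul.
Qed.

Lemma polybounded_comp (X Y : Type) (s : X -> nat) (t f : Y -> nat)
    (h : X -> Y) :
  polybounded t f -> polybounded s (fun x => t (h x)) ->
  polybounded s (fun x => f (h x)).
Proof.
move=> [k fk] st.
have [l hl] := polybounded_add st (polybounded_cst s 2).
exists (l * k) => x; apply: leq_trans (fk _) _.
by rewrite expnM; apply: leq_expn.
Qed.

Lemma exp_of_polybounded (X : Type) (s f : X -> nat) :
  polybounded s f -> exists k, forall x, f x <= s x ^ k + k.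
Proof.
(* For s >= 2, s + 2 <= s^2 gives the exponent 2k; for s <= 1 the left side is at most 3^k. *)
move=> [k fk]; exists (k.*2 + 3 ^ k) => x; apply: leq_trans (fk x) _.
case: (leqP 2 (s x)) => [s2|]; last first.
  move=> s1; apply: leq_trans (leq_addl _ _).
  apply: leq_trans (leq_addl _ _).
  by apply: leq_expn; move: s1; lia.
apply: leq_trans (leq_addr _ _); apply: (@leq_trans (s x ^ k.*2)).
  rewrite -mul2n expnM; apply: leq_expn.
  by move: s2; rewrite expnS expn1; nia.
by rewrite leq_pexp2l ?leq_addr //; apply: leq_trans s2.
Qed.

(** * Timed runs and the movement of stack contents *)

Lemma state_eq (u v : state) :
  work u =1 work v -> query u = query v -> answer u = answer v -> u = v.
Proof.
by case: u v => [w q a] [w' q' a'] /= /funext -> -> ->.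
Qed.

Definition setstack (u : state) (i : nat) (w : seq bool) : state :=
  State [eta work u with i |-> w] (query u) (answer u).

(** Only an upper bound on the time is kept, so that bounds can be rounded up and added without
    exact step counts. *)
Definition runs g (p : prog) (u : state) (T : nat) (v : state) : Prop :=
  exists2 t, t <= T & exec g p u t v.

Lemma runs_le g p u T T' v : T <= T' -> runs g p u T v -> runs g p u T' v.
Proof. by move=> TT' [t tT e]; exists t => //; exact: leq_trans TT'. Qed.

Lemma runs_seq g p q u v w T T' :
  runs g p u T v -> runs g q v T' w -> runs g (Seq p q) u (T + T') w.
Proof.
move=> [t tT e] [t' tT' e']; exists (t + t'); first exact: leq_add.
exact: ExecSeq e e'.
Qed.

Lemma runs_case g s p0 p1 p2 u T v :
  runs g (branch (contents u s) p0 p1 p2) u T v ->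
  runs g (Case s p0 p1 p2) u T.+1 v.
Proof. by move=> [t tT e]; exists t.+1 => //; exact: ExecCase. Qed.

Lemma runs_while g s p u v w T T' :
  contents u s <> [::] -> runs g p u T v -> runs g (While s p) v T' w ->
  runs g (While s p) u (T + T').+1 w.
Proof.
move=> ne [t tT e] [t' tT' e']; exists (t + t').+1; first exact: leq_add.
exact: ExecWhileStep e e'.
Qed.

Lemma runs_stop g s p u : contents u s = [::] -> runs g (While s p) u 1 u.
Proof. by move=> e; exists 1 => //; exact: ExecWhileStop. Qed.

Lemma runs_push g b i u :
  runs g (Push b i) u 1 (setstack u i (b :: work u i)).
Proof. by exists 1 => //; exact: ExecPush. Qed.

Lemma runs_pop g i u :
  runs g (Pop (Work i)) u 1 (setstack u i (behead (work u i))).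
Proof. by exists 1 => //; exact: (ExecPop _ (Work i)). Qed.

Ltac stacks :=
  apply: state_eq => //= ?;
  rewrite /= ?eqxx;
  repeat (case: eqVneq => [?|?] //=; try (by lia); try (subst => //=));
  try (by (lia || congruence)).

Lemma setstack_id u i w : work u i = w -> setstack u i w = u.
Proof. by move=> e; stacks. Qed.

Lemma setstackK u i w w' : setstack (setstack u i w) i w' = setstack u i w'.
Proof. by stacks. Qed.

Lemma work_setstack u i w : work (setstack u i w) i = w.
Proof. by rewrite /= eqxx. Qed.

Lemma work_setstack_neq u i j w : j != i -> work (setstack u i w) j = work u j.
Proof. by move=> /negbTE /= ->. Qed.

Definition clear i := While (Work i) (Pop (Work i)).

Lemma runs_clear g i u :
  runs g (clear i) u (2 * size (work u i)).+1 (setstack u i [::]).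
Proof.
move ew: (work u i) => w; elim: w u ew => [|b w IH] u ew.
  by rewrite setstack_id //; exact: runs_stop.
have := IH (setstack u i (behead (work u i))).
rewrite work_setstack ew /= setstackK => /(_ erefl) IH'.
have := runs_pop g i u; rewrite ew /= => pop_i.
apply: runs_le (runs_while _ pop_i IH') => /=; first lia.
by rewrite ew.
Qed.

Definition shift i j :=
  While (Work i) (Case (Work i) Skip
    (Seq (Push false j) (Pop (Work i))) (Seq (Push true j) (Pop (Work i)))).

Lemma runs_shift g i j u : i != j ->
  runs g (shift i j) u (4 * size (work u i)).+1
    (setstack (setstack u j (catrev (work u i) (work u j))) i [::]).
Proof.
move=> ij; move ew: (work u i) => w; elim: w u ew => [|b w IH] u ew.
  by rewrite !setstack_id //; exact: runs_stop.
pose u' := setstack (setstack u j (b :: work u j)) i w.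
have step : runs g (Seq (Push b j) (Pop (Work i))) u 2 u'.
  have := runs_pop g i (setstack u j (b :: work u j)).
  by rewrite work_setstack_neq // ew => /(runs_seq (runs_push g b j u)).
have := IH u'; rewrite work_setstack => /(_ erefl) IH'.
apply: (@runs_le _ _ _ (3 + (4 * size w).+1).+1); first by move=> /=; lia.
apply: (@runs_while _ _ _ _ u') => /=; rewrite ?ew //.
  by apply: runs_case; rewrite /= ew; case: (b) step.
congr runs: IH'; rewrite /u'; stacks.
Qed.

Definition dup t i j :=
  While (Work t) (Case (Work t) Skip
    (Seq (Push false i) (Seq (Push false j) (Pop (Work t))))
    (Seq (Push true i) (Seq (Push true j) (Pop (Work t))))).

Lemma runs_dup g t i j u : t != i -> t != j -> i != j ->
  runs g (dup t i j) u (5 * size (work u t)).+1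
    (setstack (setstack (setstack u i (catrev (work u t) (work u i)))
       j (catrev (work u t) (work u j))) t [::]).
Proof.
move=> ti tj ij; move ew: (work u t) => w; elim: w u ew => [|b w IH] u ew.
  rewrite (setstack_id (u := u)) // (setstack_id (u := u)) //.
  by rewrite setstack_id //; exact: runs_stop.
pose u' := setstack (setstack (setstack u i (b :: work u i))
                       j (b :: work u j)) t w.
have step : runs g (Seq (Push b i) (Seq (Push b j) (Pop (Work t)))) u 3 u'.
  apply: (runs_seq (runs_push g b i u)).
  have := runs_push g b j (setstack u i (b :: work u i)).
  rewrite work_setstack_neq 1?eq_sym // => /runs_seq; apply.
  have := runs_pop g t
    (setstack (setstack u i (b :: work u i)) j (b :: work u j)).
  by rewrite !work_setstack_neq // ew.
have := IH u'; rewrite work_setstack => /(_ erefl) IH'.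
apply: (@runs_le _ _ _ (4 + (5 * size w).+1).+1); first by move=> /=; lia.
apply: (@runs_while _ _ _ _ u') => /=; rewrite ?ew //.
  by apply: runs_case; rewrite /= ew; case: (b) step.
congr runs: IH'; rewrite /u'; stacks.
Qed.

(** Popping onto another stack reverses a string, so a move passes twice, through the scratch stack
    [t]. *)
Definition mv i j t := Seq (shift i t) (shift t j).

Lemma runs_mv g i j t u : i != j -> i != t -> j != t ->
  work u j = [::] -> work u t = [::] ->
  runs g (mv i j t) u (8 * size (work u i) + 2)
    (setstack (setstack u j (work u i)) i [::]).
Proof.
move=> ij it jt ej et; have s1 := runs_shift g u it.
set v := setstack _ i _ in s1.
have vt : work v t = rev (work u i).
  by rewrite /v work_setstack_neq 1?eq_sym // work_setstack et.
have vj : work v j = [::] by rewrite /v !work_setstack_neq // eq_sym.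
have tj : t != j by rewrite eq_sym.
have := runs_seq s1 (runs_shift g v tj).
rewrite vt vj size_rev -[catrev _ [::]]/(rev _) revK /v => s2.
apply: (@runs_le _ _ _ ((4 * size (work u i)).+1 + (4 * size (work u i)).+1)).
  lia.
congr runs: s2; stacks.
Qed.

Definition copy i j t := Seq (shift i t) (dup t i j).

Lemma runs_copy g i j t u : i != j -> i != t -> j != t ->
  work u j = [::] -> work u t = [::] ->
  runs g (copy i j t) u (9 * size (work u i) + 2) (setstack u j (work u i)).
Proof.
move=> ij it jt ej et; have s1 := runs_shift g u it.
set v := setstack _ i _ in s1.
have vt : work v t = rev (work u i).
  by rewrite /v work_setstack_neq 1?eq_sym // work_setstack et.
have vj : work v j = [::] by rewrite /v !work_setstack_neq // eq_sym.
have vi : work v i = [::] by rewrite /v work_setstack.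
have tj : t != j by rewrite eq_sym.
have ti : t != i by rewrite eq_sym.
have := runs_seq s1 (runs_dup g v ti tj ij).
rewrite vt vj vi size_rev -[catrev _ [::]]/(rev _) revK /v => s2.
apply: (@runs_le _ _ _ ((4 * size (work u i)).+1 + (5 * size (work u i)).+1)).
  lia.
congr runs: s2; stacks.
Qed.

(** A long oracle answer lands on the answer tape only, so a work stack grows by at most one bit per
    step. *)
Lemma exec_size g p u t v : exec g p u t v ->
  forall i, size (work v i) <= size (work u i) + t.
Proof.
elim=> {p u t v} /= [u i|b i u j|s u i|b u i|u i|p q u v w t t' _ IH1 _ IH2 i|
  s p0 p1 p2 u t v _ IH i|s p u _ i|s p u v w t t' _ _ IH1 _ IH2 i]; try lia.
- by case: eqVneq => [->|_] /=; lia.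
- case: s => [j|] /=; last lia.
  by case: eqVneq => [->|_]; rewrite ?size_behead; lia.
- by move: (IH1 i) (IH2 i); lia.
- by move: (IH i); lia.
- by move: (IH1 i) (IH2 i); lia.
Qed.

(* The first [Ask] empties the query tape; its answer may be very long, but    *)
(* the second one replaces it by [g [::]], whose length is a constant.         *)
Definition reset := Seq Ask (Seq Ask (While Answer (Pop Answer))).

Lemma runs_reset g u :
  runs g reset u (2 * size (g [::]) + 3) (State (work u) [::] [::]).
Proof.
have run_ask v : runs g Ask v 1 (ask g v) by exists 1 => //; exact: ExecAsk.
suff clear_answer w : runs g (While Answer (Pop Answer))
    (State (work u) [::] w) (2 * size w).+1 (State (work u) [::] [::]).
  have := runs_seq (run_ask u) (runs_seq (run_ask (ask g u))
    (clear_answer (g [::]))).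
  by apply: runs_le => /=; lia.
elim: w => [|b w IH]; first exact: runs_stop.
have pop_answer : runs g (Pop Answer) (State (work u) [::] (b :: w)) 1
    (State (work u) [::] w) by exists 1 => //; exact: (ExecPop _ Answer).
by apply: runs_le (runs_while _ pop_answer IH) => //=; lia.
Qed.

(** * Running a program on relocated stacks *)

Definition glue (W : nat -> seq bool) (c : nat) (u : state) : state :=
  State (fun i => if i < c then W i else work u (i - c)) (query u) (answer u).

Definition shift_stack c (s : stack) : stack :=
  if s is Work i then Work (c + i) else Answer.

Fixpoint shift_prog c (p : prog) : prog :=
  match p with
  | Skip => Skip
  | Push b i => Push b (c + i)
  | Pop s => Pop (shift_stack c s)
  | Write b => Write b
  | Ask => Ask
  | Seq p q => Seq (shift_prog c p) (shift_prog c q)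
  | Case s p q r => Case (shift_stack c s)
      (shift_prog c p) (shift_prog c q) (shift_prog c r)
  | While s p => While (shift_stack c s) (shift_prog c p)
  end.

Lemma contents_glue W c u s :
  contents (glue W c u) (shift_stack c s) = contents u s.
Proof. by case: s => [i|] //=; rewrite ltnNge leq_addr addKn. Qed.

Lemma glue_setstack W c u i w :
  glue W c (setstack u i w) = setstack (glue W c u) (c + i) w.
Proof.
apply: state_eq => //= j; rewrite /=.
case: (eqVneq j (c + i)) => [->|ne].
  by rewrite ltnNge leq_addr addKn !eqxx.
by case: ltnP => // cj; case: eqVneq => // e; move: ne; rewrite -e; lia.
Qed.

(** A shifted program never touches the stacks below [c], so they may hold the data of a caller. *)
Lemma exec_glue g p u t v W c : exec g p u t v ->
  exec g (shift_prog c p) (glue W c u) t (glue W c v).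
Proof.
elim=> {p u t v} /=.
- by move=> u; exact: ExecSkip.
- move=> b i u; rewrite -[push b i u]/(setstack u i _) glue_setstack.
  have -> : work u i = work (glue W c u) (c + i).
    by rewrite /= ltnNge leq_addr addKn.
  exact: ExecPush.
- case=> [i|] u; last exact: (ExecPop g Answer).
  rewrite -[pop _ u]/(setstack u i _) glue_setstack.
  have -> : work u i = work (glue W c u) (c + i).
    by rewrite /= ltnNge leq_addr addKn.
  exact: (ExecPop g (Work (c + i))).
- by move=> b u; exact: ExecWrite.
- by move=> u; exact: ExecAsk.
- by move=> p q u v w t t' _ IH1 _ IH2; exact: ExecSeq IH1 IH2.
- move=> s p0 p1 p2 u t v _ IH; apply: ExecCase; rewrite contents_glue.
  by case: (contents u s) IH => [|[] ?].
- by move=> s p u e; apply: ExecWhileStop; rewrite contents_glue.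
- move=> s p u v w t t' ne _ IH1 _ IH2.
  by apply: ExecWhileStep IH1 IH2; rewrite contents_glue.
Qed.

Fixpoint stack_bound (p : prog) : nat :=
  match p with
  | Push _ i | Pop (Work i) => i.+1
  | Seq p q => maxn (stack_bound p) (stack_bound q)
  | Case _ p q r => maxn (stack_bound p) (maxn (stack_bound q) (stack_bound r))
  | While _ p => stack_bound p
  | _ => 0
  end.

(** This confines the garbage left by a program to finitely many stacks, which a caller can
    clear. *)
Lemma exec_frame g p u t v : exec g p u t v ->
  forall i, stack_bound p <= i -> work v i = work u i.
Proof.
elim=> {p u t v} //= [b i u j ij|s u i|p q u v w t t' _ IH1 _ IH2 i|
  s p0 p1 p2 u t v _ IH i|s p u v w t t' _ _ IH1 _ IH2 i].
- by case: eqVneq => // e; move: ij; rewrite e ltnn.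
- case: s => [j|] //= ij.
  by case: eqVneq => // e; move: ij; rewrite e ltnn.
- by rewrite geq_max => /andP[hp hq]; rewrite IH2 // IH1.
- rewrite !geq_max => /and3P[h0 h1 h2]; apply: IH.
  by case: (contents u s) => [|[] ?].
- by move=> h; rewrite IH2 // IH1.
Qed.

(** * Polynomial-time string functions *)

Lemma runs_end g p u T v v' : runs g p u T v -> v = v' -> runs g p u T v'.
Proof. by move=> run <-. Qed.

Definition clean (b : nat) (u : state) : Prop :=
  [/\ forall i, b <= i -> work u i = [::], query u = [::] & answer u = [::]].

Lemma clean_setstack b u w : clean b u -> clean b.+1 (setstack u b w).
Proof.
move=> [wu qu au]; split => //= i bi; rewrite wu ?(ltnW bi) //.
by case: eqVneq => // e; move: bi; rewrite e ltnn.
Qed.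

Lemma cleanS b u : clean b u -> clean b.+1 u.
Proof. by move=> [wu qu au]; split => // i bi; rewrite wu // ltnW. Qed.

Lemma map_setstack (ps : seq nat) b u w : all (ltn^~ b) ps ->
  map (work (setstack u b w)) ps = map (work u) ps.
Proof.
move=> /allP ltb; apply/eq_in_map => p /ltb /= pb.
by case: eqVneq => // e; move: pb; rewrite e ltnn.
Qed.

Lemma all_ltnS (ps : seq nat) b : all (ltn^~ b) ps -> all (ltn^~ b.+1) ps.
Proof. by apply: sub_all => p /= /ltnW. Qed.

Definition sizes (X : Type) (ins : seq (X -> seq bool)) (x : X) : nat :=
  sumn [seq size (i x) | i <- ins].

(* Calling convention: the inputs [i x], [i] in [ins], lie on the stacks [ps]  *)
(* below [b], where they are kept; the stacks from [b] on are scratch space,   *)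
(* of which only [b] is left nonempty, with the result [f x].                  *)
Definition fp g (X : Type) (ins : seq (X -> seq bool)) (f : X -> seq bool) :
    Prop :=
  forall ps b, size ps = size ins -> all (ltn^~ b) ps ->
  exists (P : prog) (T : X -> nat), polybounded (sizes ins) T /\
    forall x u, clean b u -> map (work u) ps = [seq i x | i <- ins] ->
    runs g P u (T x) (setstack u b (f x)).

Lemma polybounded_exp (X : Type) (s f : X -> nat) k :
  polybounded s f -> polybounded s (fun x => (f x + 2) ^ k).
Proof.
by move=> sf; apply: (polybounded_comp (t := id) (f := fun n => (n + 2) ^ k));
  first by exists k.
Qed.

(** The result grows on an empty stack by at most one bit per step, so the running time bounds its
    length. *)
Lemma fp_polybounded g (X : Type) (ins : seq (X -> seq bool)) f :
  fp g ins f -> polybounded (sizes ins) (fun x => size (f x)).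
Proof.
pose n := size ins; move=> /(_ (iota 0 n) n); rewrite size_iota.
have alln : all (ltn^~ n) (iota 0 n) by apply/allP => i; rewrite mem_iota.
move=> /(_ erefl alln) [P [T [polyT runP]]].
apply: polybounded_le polyT => x.
have [||t tT /exec_size] := runP x (init [seq i x | i <- ins]).
- by split=> //= i ni; rewrite nth_default // size_map.
- by rewrite /= map_nth_iota0 ?size_map // take_oversize ?size_map.
move=> /(_ n); rewrite work_setstack /= nth_default ?size_map //.
by move=> /leq_trans; apply.
Qed.

Lemma size_nth_sizes (X : Type) (ins : seq (X -> seq bool)) j x :
  size (nth (fun=> [::]) ins j x) <= sizes ins x.
Proof.
elim: ins j => [|i ins IH] [|j] //=; rewrite /sizes /= ?leq_addr //.
exact: leq_trans (IH j) (leq_addl _ _).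
Qed.

Lemma fp_var g (X : Type) (ins : seq (X -> seq bool)) j :
  j < size ins -> fp g ins (nth (fun=> [::]) ins j).
Proof.
move=> jn ps b sps /allP ltb; pose p := nth 0 ps j.
have pb : p < b by apply: ltb; rewrite mem_nth // sps.
exists (copy p b b.+1), (fun x => 9 * sizes ins x + 2); split.
  apply: polybounded_add (polybounded_cst _ _).
  exact: polybounded_mul (polybounded_cst _ _) (polybounded_size _).
move=> x u [wu _ _] e.
have -> : nth (fun=> [::]) ins j x = work u p.
  rewrite -(nth_map 0 [::]) ?sps // e (nth_map (fun=> [::])) //.
apply: runs_le (runs_copy g _ _ _ (wu b _) (wu b.+1 _)); try lia.
suff : size (work u p) <= sizes ins x by lia.
rewrite -(nth_map 0 [::]) ?sps // e (nth_map (fun=> [::])) //.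
exact: size_nth_sizes.
Qed.

Lemma fp_const g (X : Type) (ins : seq (X -> seq bool)) s :
  fp g ins (fun=> s).
Proof.
move=> ps b _ _.
exists (foldr (fun c P => Seq P (Push c b)) Skip s), (fun=> (size s).+1).
split=> [|_ u [wu _ _] _]; first exact: polybounded_cst.
elim: s => [|c s IH] /=.
  by rewrite setstack_id ?wu //; exists 1 => //; exact: ExecSkip.
have := runs_push g c b (setstack u b s).
rewrite work_setstack setstackK => /(runs_seq IH).
by rewrite addn1.
Qed.

Arguments fp_const {g X ins} s.

Lemma fp_cons g (X : Type) (ins : seq (X -> seq bool)) c f :
  fp g ins f -> fp g ins (fun x => c :: f x).
Proof.
move=> F ps b sps ltb; have [P [T [polyT runP]]] := F ps b sps ltb.
exists (Seq P (Push c b)), (fun x => T x + 1); split.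
  exact: polybounded_add polyT (polybounded_cst _ _).
move=> x u cu e; have := runs_push g c b (setstack u b (f x)).
by rewrite work_setstack setstackK => /(runs_seq (runP x u cu e)).
Qed.

Lemma fp_behead g (X : Type) (ins : seq (X -> seq bool)) f :
  fp g ins f -> fp g ins (fun x => behead (f x)).
Proof.
move=> F ps b sps ltb; have [P [T [polyT runP]]] := F ps b sps ltb.
exists (Seq P (Pop (Work b))), (fun x => T x + 1); split.
  exact: polybounded_add polyT (polybounded_cst _ _).
move=> x u cu e; have := runs_pop g b (setstack u b (f x)).
by rewrite work_setstack setstackK => /(runs_seq (runP x u cu e)).
Qed.

Lemma runs_clear_top g b u w : clean b u ->
  runs g (clear b) (setstack u b w) (2 * size w).+1 u.
Proof.
move=> [wu _ _]; have := runs_clear g b (setstack u b w).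
by rewrite work_setstack setstackK (@setstack_id u b [::]) ?wu.
Qed.

Lemma fp_case g (X : Type) (ins : seq (X -> seq bool)) u f0 f1 f2 :
  fp g ins u -> fp g ins f0 -> fp g ins f1 -> fp g ins f2 ->
  fp g ins (fun x => match u x with
    | [::] => f0 x | false :: _ => f1 x | true :: _ => f2 x end).
Proof.
move=> U F0 F1 F2 ps b sps ltb; have polyu := fp_polybounded U.
have [P [T [polyT runP]]] := U ps b sps ltb.
have [P0 [T0 [polyT0 runP0]]] := F0 ps b sps ltb.
have [P1 [T1 [polyT1 runP1]]] := F1 ps b sps ltb.
have [P2 [T2 [polyT2 runP2]]] := F2 ps b sps ltb.
exists (Seq P (Case (Work b) P0 (Seq (clear b) P1) (Seq (clear b) P2))).
exists (fun x => T x + (2 * size (u x) + 2 + (T0 x + (T1 x + T2 x)))); split.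
  apply: polybounded_add => //; apply: polybounded_add.
    apply: polybounded_add (polybounded_cst _ _).
    exact: polybounded_mul (polybounded_cst _ _) polyu.
  by do 2!apply: polybounded_add => //.
move=> x v cv e; apply: (runs_seq (runP x v cv e)).
apply: (@runs_le _ _ _ (2 * size (u x) + 1 + (T0 x + (T1 x + T2 x))).+1).
  lia.
apply: runs_case; rewrite /= eqxx.
have cl w := runs_clear_top g w cv.
case eu : (u x) => [|[] w] /=.
- apply: runs_le (_ : runs g P0 _ (T0 x) _); first lia.
  rewrite setstack_id; first exact: runP0.
  by case: cv => wu _ _; rewrite wu.
- by apply: runs_le (runs_seq (cl _) (runP2 x v cv e)) => /=; lia.
- by apply: runs_le (runs_seq (cl _) (runP1 x v cv e)) => /=; lia.
Qed.

Definition ret (d s t : nat) := Seq (clear d) (mv s d t).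

Lemma runs_ret g d s t u : s != d -> s != t -> d != t -> work u t = [::] ->
  runs g (ret d s t) u (2 * size (work u d) + 8 * size (work u s) + 3)
    (setstack (setstack u d (work u s)) s [::]).
Proof.
move=> sd st dt et; have s1 := runs_clear g d u.
have := @runs_mv g s d t (setstack u d [::]) sd st dt.
rewrite work_setstack !work_setstack_neq // 1?eq_sym // setstackK.
move=> /(_ erefl et) /(runs_seq s1); apply: runs_le; lia.
Qed.

(** The value of [u] is stored as one more input at the bottom of the scratch space, which raises
    [b] by one; afterwards the result is moved down in its place. *)
Lemma fp_let g (X : Type) (ins : seq (X -> seq bool)) u f :
  fp g ins u -> fp g (u :: ins) f -> fp g ins f.
Proof.
move=> U F ps b sps ltb; have polyu := fp_polybounded U.
have polyf := fp_polybounded F.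
have [P [T [polyT runP]]] := U ps b sps ltb.
have [|| Q [V [polyV runQ]]] := F (b :: ps) b.+1; first by rewrite /= sps.
  by rewrite /= ltnS leqnn all_ltnS.
have sz h : polybounded (sizes (u :: ins)) h -> polybounded (sizes ins) h.
  move=> ph; apply: (polybounded_comp (h := id) ph).
  exact: polybounded_add polyu (polybounded_size _).
exists (Seq P (Seq Q (ret b b.+1 b.+2))).
exists (fun x => T x + (V x + (2 * size (u x) + 8 * size (f x) + 3))); split.
  apply: polybounded_add => //; apply: polybounded_add; first exact: sz.
  apply: polybounded_add (polybounded_cst _ _).
  apply: polybounded_add; apply: polybounded_mul (polybounded_cst _ _) _ => //.
  exact: sz.
move=> x v cv e; apply: (runs_seq (runP x v cv e)).
have run2 := runQ x _ (clean_setstack (u x) cv).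
rewrite /= map_setstack // eqxx e in run2.
apply: runs_seq (run2 erefl) _.
case: cv => wv _ _.
have := @runs_ret g b b.+1 b.+2 (setstack (setstack v b (u x)) b.+1 (f x)).
rewrite work_setstack !(work_setstack_neq _ _ (_ : b != b.+1)) ?work_setstack;
  try lia.
rewrite !work_setstack_neq; try lia.
rewrite wv; last lia.
move=> run3; have {}run3 := run3 _ _ _ erefl.
apply: (@runs_le _ _ _ (2 * size (u x) + 8 * size (f x) + 3)) => //.
apply: (runs_end (run3 _ _ _)); try lia.
by stacks; rewrite wv.
Qed.

Lemma fp_weak g (X Y : Type) (ins : seq (Y -> seq bool)) f (h : X -> Y)
    pre post :
  fp g ins f -> fp g (pre ++ [seq i \o h | i <- ins] ++ post) (f \o h).
Proof.
move=> F ps b; rewrite !size_cat size_map => sps ltb.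
pose qs := take (size ins) (drop (size pre) ps).
have sqs : size qs = size ins.
  by rewrite /qs size_take_min size_drop sps; lia.
have ltq : all (ltn^~ b) qs.
  by apply/allP => p /mem_take /mem_drop; apply: (allP ltb).
have [P [T [polyT runP]]] := F qs b sqs ltq.
exists P, (T \o h); split.
  apply: (polybounded_comp polyT).
  apply: polybounded_le (polybounded_size _) => x.
  rewrite /sizes !map_cat !sumn_cat -map_comp -[X in X <= _]add0n.
  by rewrite leq_add // leq_addr.
move=> x u cu e; apply: runP => //.
rewrite /qs map_take map_drop e !map_cat -map_comp drop_size_cat ?size_map //.
by rewrite take_size_cat // size_map.
Qed.

(** Composition in all inputs at once: [f] is first weakened along [h], then its inputs are bound
    one after another by [fp_let]. *)
Lemma fp_sub g (X Y : Type) (ins : seq (Y -> seq bool)) f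
    (ins' : seq (X -> seq bool)) (h : X -> Y) :
  fp g ins f -> foldr (fun i => and (fp g ins' (i \o h))) True ins ->
  fp g ins' (f \o h).
Proof.
move=> /(@fp_weak _ _ _ _ _ h [::] ins') /=.
elim: ins => [|i ins IH] //= F [Fi Fins].
apply: IH => //; apply: fp_let F.
have := @fp_weak _ _ _ _ _ id [seq j \o h | j <- ins] [::] Fi.
rewrite cats0.
have -> // : [seq j \o id | j <- ins'] = ins'.
by elim: (ins') => //= j l ->.
Qed.

Lemma fp_lift g (X Y : Type) (ins : seq (Y -> seq bool)) f (h : X -> Y) pre :
  fp g ins f -> fp g (pre ++ [seq i \o h | i <- ins]) (f \o h).
Proof. by move=> /(@fp_weak _ _ _ _ _ h pre [::]); rewrite cats0. Qed.

(** * Recursion on notation and subroutine calls *)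

Fixpoint recn (f0 : seq bool) (h : bool -> seq bool -> seq bool -> seq bool)
    (w : seq bool) : seq bool :=
  if w is b :: w' then h b w' (recn f0 h w') else f0.

Definition rec_ins (X : Type) (ins : seq (X -> seq bool)) :
    seq (X * (seq bool * seq bool) -> seq bool) :=
  [:: (fun z => z.2.2), (fun z => z.2.1) & [seq i \o fst | i <- ins]].

Lemma setstack_move u d s w : d != s -> work u s = [::] ->
  setstack (setstack (setstack u s w) d w) s [::] = setstack u d w.
Proof. by move=> ds e; stacks. Qed.

(* The loop keeps the value at the current suffix on [b], that suffix on       *)
(* [b.+1] and the rest of the string, reversed, on [b.+2].                     *)
Lemma fp_rec g (X : Type) (ins : seq (X -> seq bool)) u f0
    (h : bool -> X * (seq bool * seq bool) -> seq bool) B :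
  fp g ins u -> fp g ins f0 -> (forall c, fp g (rec_ins ins) (h c)) ->
  polybounded (sizes ins) B ->
  (forall x w, size w <= size (u x) ->
    size (recn (f0 x) (fun c w a => h c (x, (w, a))) w) <= B x) ->
  fp g ins (fun x => recn (f0 x) (fun c w a => h c (x, (w, a))) (u x)).
Proof.
move=> U F0 H polyB hB ps b sps ltb; have polyu := fp_polybounded U.
have [P0 [T0 [polyT0 runP0]]] := F0 ps b sps ltb.
have [P [T [polyT runP]]] := U ps b.+1 sps (all_ltnS ltb).
have step c : exists Q V, polybounded (sizes (rec_ins ins)) V /\
    forall x w a v, clean b.+3 v ->
      map (work v) ps = [seq i x | i <- ins] ->
      work v b.+1 = w -> work v b = a ->
      runs g Q v (V (x, (w, a))) (setstack v b.+3 (h c (x, (w, a)))).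
  have [|| Q [V [polyV runQ]]] := H c [:: b, b.+1 & ps] b.+3.
  - by rewrite /= size_map sps.
  - by rewrite /= !all_ltnS // !andbT; lia.
  exists Q, V; split => // x w a v cv e ew ea; apply: runQ => //.
  by rewrite /= ew ea e -map_comp.
have [Q0 [V0 [polyV0 runQ0]]] := step false.
have [Q1 [V1 [polyV1 runQ1]]] := step true.
have [k0 hk0] := polyV0; have [k1 hk1] := polyV1.
(* The bound [B] on all intermediate values bounds the input size of every iteration by [S x], so
   one polynomial [D] covers each pass through the loop. *)
pose S x := B x + (size (u x) + sizes ins x).
have polyS : polybounded (sizes ins) S.
  apply: polybounded_add => //; apply: polybounded_add => //.
  exact: polybounded_size.
pose D x := (S x + 2) ^ k0 + (S x + 2) ^ k1 + (10 * B x + 8).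
have polyD : polybounded (sizes ins) D.
  apply: polybounded_add.
    by apply: polybounded_add; exact: polybounded_exp.
  apply: polybounded_add (polybounded_cst _ _).
  exact: polybounded_mul (polybounded_cst _ _) polyB.
pose next c Q := Seq (Seq Q (ret b b.+3 b.+4))
                     (Seq (Pop (Work b.+2)) (Push c b.+1)).
pose loop := While (Work b.+2)
  (Case (Work b.+2) Skip (next false Q0) (next true Q1)).
exists (Seq P0 (Seq P (Seq (shift b.+1 b.+2) (Seq loop (clear b.+1))))).
exists (fun x => T0 x + (T x + ((4 * size (u x)).+1 +
   ((size (u x) * (D x).+2).+1 + (2 * size (u x)).+1)))); split.
  apply: polybounded_add => //; apply: polybounded_add => //.
  apply: polybounded_add; last apply: polybounded_add.
  - apply: (polybounded_add (polybounded_cst _ 1)).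
    exact: polybounded_mul (polybounded_cst _ _) polyu.
  - apply: (polybounded_add (polybounded_cst _ 1)).
    apply: polybounded_mul => //.
    exact: (polybounded_add (polybounded_cst _ 2)).
  - apply: (polybounded_add (polybounded_cst _ 1)).
    exact: polybounded_mul (polybounded_cst _ _) polyu.
move=> x v cv e; set r := recn _ _; have [wv qv av] := cv.
apply: runs_seq (runP0 x v cv e) _.
apply: (runs_seq (runP x _ (clean_setstack _ cv) _)).
  by rewrite map_setstack.
pose st tail cnt := setstack (setstack (setstack v b (r tail)) b.+1 tail)
                      b.+2 cnt.
have run1 := @runs_shift g b.+1 b.+2
  (setstack (setstack v b (f0 x)) b.+1 (u x)).
rewrite work_setstack in run1.
apply: (@runs_seq _ _ _ _ (st [::] (rev (u x)))).
  apply: (runs_end (run1 _)); first lia.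
  by rewrite /st; stacks; rewrite wv //; lia.
have run2 : runs g loop (st [::] (rev (u x))) (size (u x) * (D x).+2).+1
    (st (u x) [::]).
  (* Invariant: the unread part in its original order, followed by the processed suffix, is [u x],
     and stack [b] holds the value at that suffix. *)
  suff run_loop cnt : forall tail, rev cnt ++ tail = u x ->
      runs g loop (st tail cnt) (size cnt * (D x).+2).+1 (st (u x) [::]).
    by rewrite -(size_rev (u x)); apply: run_loop; rewrite cats0 revK.
  elim: cnt => [|c cnt IH] tail.
    by rewrite mul0n /= => ->; apply: runs_stop; rewrite /= eqxx.
  rewrite rev_cons cat_rcons => eu.
  have stail : size (c :: tail) <= size (u x).
    by rewrite -eu size_cat leq_addl.
  pose Q := if c then Q1 else Q0.
  have run_next :
      runs g (next c Q) (st tail (c :: cnt)) (D x) (st (c :: tail) cnt).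
    pose v1 := st tail (c :: cnt).
    have cv1 : clean b.+3 v1 by do 3!apply: clean_setstack.
    have e1 : map (work v1) ps = [seq i x | i <- ins].
      by rewrite /v1 /st !map_setstack ?all_ltnS.
    have e2 : work v1 b.+1 = tail.
      by rewrite /v1 /st /= eqxx ifN //; lia.
    have e3 : work v1 b = r tail.
      by rewrite /v1 /st /= eqxx !ifN //; lia.
    have V_le : V0 (x, (tail, r tail)) <= (S x + 2) ^ k0 /\
                V1 (x, (tail, r tail)) <= (S x + 2) ^ k1.
      have le_S : sizes (rec_ins ins) (x, (tail, r tail)) <= S x.
        rewrite /sizes /= -map_comp /S leq_add //.
          by apply: hB; exact: ltnW.
        by rewrite leq_add2r ltnW.
      by split; [apply: leq_trans (hk0 _) _|apply: leq_trans (hk1 _) _];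
        apply: leq_expn; rewrite leq_add2r.
    have runQ : runs g Q v1 ((S x + 2) ^ k0 + (S x + 2) ^ k1)
        (setstack v1 b.+3 (r (c :: tail))).
      rewrite /Q /r /=; case: (c); [apply: runs_le (runQ1 _ _ _ _ cv1 e1 e2 e3)
        | apply: runs_le (runQ0 _ _ _ _ cv1 e1 e2 e3)]; move: V_le; lia.
    pose v2 := setstack v1 b.+3 (r (c :: tail)).
    have run3 : runs g (ret b b.+3 b.+4) v2 (10 * B x + 3)
        (setstack v1 b (r (c :: tail))).
      have run3 := @runs_ret g b b.+3 b.+4 v2.
      have e4 : work v2 b = r tail.
        by rewrite /v2 work_setstack_neq ?e3 //; lia.
      have e5 : work v2 b.+3 = r (c :: tail) by rewrite /v2 work_setstack.
      rewrite e4 e5 in run3.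
      have b1 : size (r tail) <= B x by apply: hB; exact: ltnW.
      have b2 : size (r (c :: tail)) <= B x by exact: hB.
      apply: (@runs_le _ _ _
        (2 * size (r tail) + 8 * size (r (c :: tail)) + 3)).
        lia.
      apply: runs_end (run3 _ _ _ _) _; try lia.
        case: cv1 => wv1 _ _.
        by rewrite /v2 work_setstack_neq ?wv1 //; lia.
      rewrite /v2 setstack_move //; first lia.
      by case: cv1 => wv1 _ _; rewrite wv1.
    have run4 : runs g (Seq (Pop (Work b.+2)) (Push c b.+1))
        (setstack v1 b (r (c :: tail))) 2 (st (c :: tail) cnt).
      apply: runs_end (runs_seq (runs_pop _ _ _) (runs_push _ _ _ _)) _.
      by rewrite /v1 /st /=; stacks.
    apply: runs_le (runs_seq (runs_seq runQ run3) run4).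
    by rewrite /D; lia.
  apply: (@runs_le _ _ _ ((D x).+1 + (size cnt * (D x).+2).+1).+1).
    by rewrite /=; lia.
  apply: runs_while (IH _ eu); first by rewrite /= eqxx.
  by apply: runs_case; move: run_next; rewrite /= eqxx /Q; case: (c).
apply: runs_seq run2 _.
have := runs_clear g b.+1 (st (u x) [::]).
rewrite {1}/st work_setstack_neq ?work_setstack; last lia.
by move=> run5; apply: runs_end run5 _; rewrite /st; stacks; rewrite wv //; lia.
Qed.

Lemma shift_prog_call g p es c t v u :
  exec g p (init es) t v -> query u = [::] -> answer u = [::] ->
  (forall i, work u (c + i) = nth [::] es i) ->
  exec g (shift_prog c p) u t (glue (work u) c v).
Proof.
move=> e qu au wu.
have {1}-> : u = glue (work u) c (init es); last exact: exec_glue.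
apply: state_eq => //= i; case: ltnP => // ci.
by rewrite -wu subnKC.
Qed.

Lemma runs_clears g (js : seq nat) u K :
  (forall i, i \in js -> size (work u i) <= K) ->
  runs g (foldr (fun i => Seq (clear i)) Skip js) u
    (size js * (2 * K).+1).+1
    (State (fun i => if i \in js then [::] else work u i) (query u) (answer u)).
Proof.
elim: js u => [|j js IH] u hK.
  exists 1 => //; rewrite (_ : State _ _ _ = u); first exact: ExecSkip.
  exact: state_eq.
pose u' := setstack u j [::].
have hK' i : i \in js -> size (work u' i) <= K.
  by move=> ij; rewrite /u' /=; case: eqVneq => // _; rewrite hK // inE ij orbT.
apply: (@runs_le _ _ _ ((2 * size (work u j)).+1 + (size js * (2 * K).+1).+1)).
  by have := hK j (mem_head _ _); rewrite /= mulSn; set a := _ * _; lia.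
apply: runs_end (runs_seq (runs_clear g j u) (IH u' hK')) _.
apply: state_eq => //= i; rewrite inE; case: eqVneq => [->|] //=.
by case: ifP.
Qed.

(** This turns an arbitrary program, such as the one for the given gale, into a subroutine: it
    starts above [b] with its two arguments; then the oracle tapes are reset, the wanted stack is
    moved to [b], and every stack the call can have touched is cleared. *)
Lemma fp_call g (X : Type) (ins : seq (X -> seq bool)) e1 e2 p T
    (v : X -> state) j :
  fp g ins e1 -> fp g ins e2 -> polybounded (sizes ins) T ->
  (forall x, runs g p (init [:: e1 x; e2 x]) (T x) (v x)) ->
  fp g ins (fun x => work (v x) j).
Proof.
move=> E1 E2 polyT runp ps b sps ltb; have polyf1 := fp_polybounded E1.
have polyf2 := fp_polybounded E2.
have [P1 [T1 [polyT1 runP1]]] := E1 ps b.+1 sps (all_ltnS ltb).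
have [P2 [T2 [polyT2 runP2]]] := E2 ps b.+2 sps (all_ltnS (all_ltnS ltb)).
(* [M] covers the stacks that [p] changes, its two argument stacks and the stack [j] to be read. *)
pose M := maxn (stack_bound p) (maxn 2 j.+1).
pose js := iota b.+1 M.
pose K x := size (e1 x) + size (e2 x) + T x.
exists (Seq P1 (Seq P2 (Seq (shift_prog b.+1 p) (Seq reset
  (Seq (mv (b.+1 + j) b (b.+1 + M))
    (foldr (fun i => Seq (clear i)) Skip js)))))).
exists (fun x => T1 x + (T2 x + (T x + (2 * size (g [::]) + 3 + (8 * K x + 2 +
  (M * (2 * K x).+1).+1))))); split.
  have polyK : polybounded (sizes ins) K by do 2!apply: polybounded_add => //.
  do 4!apply: polybounded_add => //.
    exact: polybounded_cst.
  apply: polybounded_add.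
    apply: polybounded_add (polybounded_cst _ _).
    exact: polybounded_mul (polybounded_cst _ _) polyK.
  apply: (polybounded_add (polybounded_cst _ 1)).
  apply: polybounded_mul (polybounded_cst _ _) _.
  apply: (polybounded_add (polybounded_cst _ 1)).
  exact: polybounded_mul (polybounded_cst _ _) polyK.
move=> x u cu e; have [wu qu au] := cu.
have cu1 : clean b.+1 u := cleanS cu.
apply: (runs_seq (runP1 x u cu1 e)).
apply: (runs_seq (runP2 x _ (clean_setstack _ cu1) _)).
  by rewrite map_setstack // all_ltnS.
set u2 := setstack _ _ _.
have [t tT exp] := runp x.
have run3 : runs g (shift_prog b.+1 p) u2 (T x) (glue (work u2) b.+1 (v x)).
  exists t => //; apply: (shift_prog_call exp) => //=.
  move=> i; case: i => [|[|i]] /=; rewrite ?addn0 ?addn1 ?eqxx.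
  - by case: eqVneq => //; lia.
  - by [].
  - case: eqVneq => [|_]; first lia.
    case: eqVneq => [|_]; first lia.
    by rewrite wu ?nth_nil //; lia.
apply: (runs_seq run3); apply: (runs_seq (runs_reset _ _)).
set u3 := State _ _ _.
have w3 i : work u3 (b.+1 + i) = work (v x) i.
  by rewrite /u3 /= ltnNge leq_addr addKn.
have sK i : size (work (v x) i) <= K x.
  apply: leq_trans (exec_size exp i) _; rewrite leq_add //.
  by case: i => [|[|i]] /=; rewrite ?nth_nil ?leq_addr ?leq_addl.
have fr i : M <= i -> work (v x) i = [::].
  rewrite /M !geq_max => /and3P[Mi i2 _].
  by rewrite (exec_frame exp Mi) /= nth_default.
have w3b : work u3 b = [::].
  rewrite /u3 /= ltnSn; case: eqVneq => [|_]; first lia.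
  by case: eqVneq => [|_]; [lia|rewrite wu].
have w3lo i : i < b -> work u3 i = work u i.
  move=> ib; rewrite /u3 /= ltnS ltnW //.
  by case: eqVneq => [|_]; [lia|case: eqVneq => // ?; lia].
have [q3 a3] : query u3 = [::] /\ answer u3 = [::] by [].
clearbody u3.
have run4 := @runs_mv g (b.+1 + j) b (b.+1 + M) u3.
rewrite !w3 w3b fr // in run4.
have jM : j < M by rewrite /M !leq_max leqnn !orbT.
have {}run4 := run4 _ _ _ erefl erefl.
apply: (@runs_le _ _ _ ((8 * size (work (v x) j) + 2) + (M * (2 * K x).+1).+1)).
  by move: (sK j); lia.
apply: (runs_seq (run4 _ _ _)); try lia.
have := @runs_clears g js
  (setstack (setstack u3 b (work (v x) j)) (b.+1 + j) [::]) (K x).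
rewrite size_iota => run5; apply: runs_end (run5 _) _.
  move=> i; rewrite mem_iota => /andP[bi iM] /=.
  case: eqVneq => // _; case: eqVneq => [|_]; first by move: bi; lia.
  have := w3 (i - b.+1); rewrite subnKC // => ->; exact: sK.
apply: state_eq => [i||] /=; rewrite ?qu ?au //= mem_iota.
case: (ltnP b i) => bi /=.
  case: ltnP => iM; first by case: eqVneq; [lia|rewrite wu // ltnW].
  case: eqVneq => [|_]; first lia.
  case: eqVneq => [|_]; first lia.
  by have := w3 (i - b.+1); rewrite subnKC // => ->; rewrite fr ?wu //; lia.
case: eqVneq => [|_]; first lia.
case: eqVneq => // ib; apply: w3lo; lia.
Qed.

(** * Binary arithmetic *)

Lemma fp_ext g (X : Type) (ins : seq (X -> seq bool)) f f' :
  fp g ins f -> f =1 f' -> fp g ins f'.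
Proof. by move=> F /funext <-. Qed.

Lemma fp_acc g (X : Type) (ins : seq (X -> seq bool)) :
  fp g (rec_ins ins) (fun z => z.2.2).
Proof. exact: (@fp_var g _ (rec_ins ins) 0). Qed.

Lemma fp_tail g (X : Type) (ins : seq (X -> seq bool)) :
  fp g (rec_ins ins) (fun z => z.2.1).
Proof. exact: (@fp_var g _ (rec_ins ins) 1). Qed.

Arguments fp_acc {g X ins}.
Arguments fp_tail {g X ins}.

Lemma fp_outer g (X : Type) (ins : seq (X -> seq bool)) u :
  fp g ins u -> fp g (rec_ins ins) (fun z => u z.1).
Proof.
exact: (@fp_lift g _ _ _ _ fst [:: (fun z => z.2.2); (fun z => z.2.1)]).
Qed.

Lemma fp_cat g (X : Type) (ins : seq (X -> seq bool)) u v :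
  fp g ins u -> fp g ins v -> fp g ins (fun x => u x ++ v x).
Proof.
move=> U V.
have recE x w : recn (v x) (fun c _ a => c :: a) w = w ++ v x.
  by elim: w => //= c w ->.
apply: fp_ext (fp_rec (h := fun c z => c :: z.2.2)
  (B := fun x => size (u x) + size (v x)) U V _ _ _) _ => //=.
- by move=> c; apply/fp_cons/fp_acc.
- exact: polybounded_add (fp_polybounded U) (fp_polybounded V).
- by move=> x w wu; rewrite recE size_cat leq_add2r.
Qed.

Lemma fp_nseq g (X : Type) (ins : seq (X -> seq bool)) b u :
  fp g ins u -> fp g ins (fun x => nseq (size (u x)) b).
Proof.
move=> U.
have recE w : recn [::] (fun _ _ a => b :: a) w = nseq (size w) b.
  by elim: w => //= c w ->.
apply: fp_ext (fp_rec (f0 := fun=> [::]) (h := fun _ z => b :: z.2.2)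
  (B := fun x => size (u x)) U _ _ _ _) _ => //=.
- exact: fp_const.
- by move=> _; apply/fp_cons/fp_acc.
- exact: (fp_polybounded U).
- by move=> x w wu; rewrite recE size_nseq.
Qed.

Lemma fp_drop g (X : Type) (ins : seq (X -> seq bool)) n u :
  fp g ins n -> fp g ins u -> fp g ins (fun x => drop (size (n x)) (u x)).
Proof.
move=> N U.
have recE x w : recn (u x) (fun _ _ a => behead a) w = drop (size w) (u x).
  by elim: w => [|c w] /=; rewrite ?drop0 // => ->; rewrite -drop1 drop_drop.
apply: fp_ext (fp_rec (h := fun _ z => behead z.2.2)
  (B := fun x => size (u x)) N U _ _ _) _ => //=.
- by move=> _; apply/fp_behead/fp_acc.
- exact: (fp_polybounded U).
- by move=> x w _; rewrite recE size_drop leq_subr.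
Qed.

Lemma fp_if_nth g (X : Type) (ins : seq (X -> seq bool)) n u f1 f2 :
  fp g ins n -> fp g ins u -> fp g ins f1 -> fp g ins f2 ->
  fp g ins (fun x => if nth false (u x) (size (n x)) then f1 x else f2 x).
Proof.
move=> N U F1 F2; apply: fp_ext (fp_case (fp_drop N U) F2 F2 F1) _ => x.
have -> : nth false (u x) (size (n x)) = head false (drop (size (n x)) (u x)).
  by rewrite -nth0 nth_drop addn0.
by case: drop => [|[]].
Qed.

(* Digitwise recursion from the most significant of [size n] digits down: the  *)
(* partial result for the digits from [i] on is obtained from that for the     *)
(* digits from [i.+1] on by [H] applied to the digits at [i].                  *)
Definition ripple (H : bool -> bool -> seq bool -> seq bool)
    (n x y : seq bool) : seq bool -> seq bool :=
  recn [::] (fun _ w z => let i := size n - (size w).+1 in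
                          H (nth false x i) (nth false y i) z).

Lemma size_ripple (H : bool -> bool -> seq bool -> seq bool) n x y w :
  (forall a c z, size (H a c z) <= (size z).+1) ->
  size (ripple H n x y w) <= size w.
Proof.
move=> sH; elim: w => //= c w IH.
exact: leq_trans (sH _ _ _) _.
Qed.

Lemma fp_ripple g (H : bool -> bool -> seq bool -> seq bool)
    (X : Type) (ins : seq (X -> seq bool)) n x y :
  (forall a c (Y : Type) (ins' : seq (Y -> seq bool)) z,
    fp g ins' z -> fp g ins' (fun t => H a c (z t))) ->
  (forall a c z, size (H a c z) <= (size z).+1) ->
  fp g ins n -> fp g ins x -> fp g ins y ->
  fp g ins (fun t => ripple H (n t) (x t) (y t) (n t)).
Proof.
move=> HH sH N U V.
pose h (c : bool) (z : X * (seq bool * seq bool)) :=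
  let i := size (n z.1) - (size z.2.1).+1 in
  H (nth false (x z.1) i) (nth false (y z.1) i) z.2.2.
apply: fp_ext (fp_rec (f0 := fun=> [::]) (h := h)
  (B := fun t => size (n t)) N _ _ _ _) _ => //.
- exact: fp_const.
- move=> c.
  (* Its length is |n| - (|w| + 1), the position of the current digit in unary. *)
  pose i (z : X * (seq bool * seq bool)) := behead (drop (size z.2.1) (n z.1)).
  have I : fp g (rec_ins ins) i.
    by apply/fp_behead/fp_drop; [exact: fp_tail|exact: fp_outer].
  have A a e : fp g (rec_ins ins) (fun z => H a e z.2.2).
    exact/HH/fp_acc.
  apply: fp_ext (fp_if_nth I (fp_outer U)
    (fp_if_nth I (fp_outer V) (A true true) (A true false))
    (fp_if_nth I (fp_outer V) (A false true) (A false false))) _ => z.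
  rewrite /h /i size_behead size_drop -subnS.
  by case: nth; case: nth.
- exact: (fp_polybounded N).
- move=> t w wn; rewrite -[recn _ _ _]/(ripple H (n t) (x t) (y t) w).
  by apply: leq_trans (size_ripple _ _ _ _ sH) wn.
Qed.

Lemma nat_of_bits_div x i :
  nat_of_bits x %/ 2 ^ i =
  nth false x i + (nat_of_bits x %/ 2 ^ i.+1).*2.
Proof.
elim: x i => [|b x IH] [|i]; rewrite ?div0n //=.
  by rewrite expn1 divn1 divn2 half_bit_double.
rewrite !(expnS _ i.+1) (expnS _ i) !divnMA !divn2 half_bit_double.
by rewrite -!divn2 -!divnMA -expnS -IH.
Qed.

Lemma nat_of_bits_lt x : nat_of_bits x < 2 ^ size x.
Proof. by elim: x => //= b x IH; rewrite expnS; case: b; lia. Qed.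

Lemma nat_of_bits_cat x y :
  nat_of_bits (x ++ y) = nat_of_bits x + 2 ^ size x * nat_of_bits y.
Proof.
by elim: x => [|b x IH] /=; rewrite ?mul1n // IH expnS doubleD -!mul2n; lia.
Qed.

Lemma nat_of_bits_zeros m : nat_of_bits (nseq m false) = 0.
Proof. by elim: m => //= m ->. Qed.

Definition succb : seq bool -> seq bool :=
  recn [::] (fun b w a => if b then false :: a else true :: w).

Definition predb : seq bool -> seq bool :=
  recn [::] (fun b w a => if b then false :: w else true :: a).

Lemma size_succb w : size (succb w) = size w.
Proof. by elim: w => //= -[] w //= ->. Qed.

Lemma size_predb w : size (predb w) = size w.
Proof. by elim: w => //= -[] w //= ->. Qed.

Lemma modn_double m (b : bool) q : (b + m.*2) %% (2 * q) = b + (m %% q).*2.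
Proof.
case: q => [|q]; first by rewrite muln0 !modn0.
rewrite {1}(divn_eq m q.+1) doubleD addnCA -muln2 -mulnA (mulnC q.+1) modnMDl.
rewrite modn_small //; have := ltn_pmod m (ltn0Sn q); case: b; lia.
Qed.

Lemma nat_of_succb w : nat_of_bits (succb w) = (nat_of_bits w).+1 %% 2 ^ size w.
Proof.
elim: w => [|b w IH] //=; rewrite expnS; case: b => /=.
  by rewrite IH (_ : (1 + _).+1 = false + (nat_of_bits w).+1.*2) ?modn_double.
rewrite (_ : (0 + _).+1 = true + (nat_of_bits w).*2) // modn_double.
by rewrite modn_small ?nat_of_bits_lt.
Qed.

Lemma nat_of_predb w : 0 < nat_of_bits w ->
  nat_of_bits (predb w) = (nat_of_bits w).-1.
Proof.
by elim: w => [|[] w IH] //= w0; rewrite ?IH; lia.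
Qed.

Lemma fp_succb g (X : Type) (ins : seq (X -> seq bool)) u :
  fp g ins u -> fp g ins (fun x => succb (u x)).
Proof.
move=> U; apply: fp_ext (fp_rec (f0 := fun=> [::])
  (h := fun c z => if c then false :: z.2.2 else true :: z.2.1)
  (B := fun x => size (u x)) U _ _ _ _) _ => //.
- exact: fp_const.
- by case; apply: fp_cons; [exact: fp_acc|exact: fp_tail].
- exact: (fp_polybounded U).
- by move=> x w; rewrite -/(succb w) size_succb.
Qed.

Lemma fp_predb g (X : Type) (ins : seq (X -> seq bool)) u :
  fp g ins u -> fp g ins (fun x => predb (u x)).
Proof.
move=> U; apply: fp_ext (fp_rec (f0 := fun=> [::])
  (h := fun c z => if c then false :: z.2.1 else true :: z.2.2)
  (B := fun x => size (u x)) U _ _ _ _) _ => //.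
- exact: fp_const.
- by case; apply: fp_cons; [exact: fp_tail|exact: fp_acc].
- exact: (fp_polybounded U).
- by move=> x w; rewrite -/(predb w) size_predb.
Qed.

(** The higher digits [z] are computed before the current one, so a carry is propagated into them at
    once by [succb]. Likewise [subh] propagates borrows, and in [cmph] the most significant
    difference decides. *)
Definition addh (a c : bool) z := (a (+) c) :: (if a && c then succb z else z).
Definition subh (a c : bool) z :=
  (a (+) c) :: (if ~~ a && c then predb z else z).
Definition cmph (a c : bool) (z : seq bool) :=
  if z is [::] then (if a == c then [::] else [:: c]) else z.

Definition addb n x y := ripple addh n x y n.
Definition subb x y := ripple subh (x ++ y) x y (x ++ y).
Definition cmpb x y := ripple cmph (x ++ y) x y (x ++ y).

Lemma size_ripple_addh n x y w : size (ripple addh n x y w) = size w.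
Proof. by elim: w => //= c w IH; case: ifP; rewrite ?size_succb IH. Qed.

Lemma size_addb n x y : size (addb n x y) = size n.
Proof. exact: size_ripple_addh. Qed.

Lemma nat_of_addb n x y :
  nat_of_bits (addb n x y) = (nat_of_bits x + nat_of_bits y) %% 2 ^ size n.
Proof.
(* Generalization for the induction: the partial result is the sum of the two numbers with their
   lower digits cut off, modulo the width reached so far. *)
suff gen w : size w <= size n -> nat_of_bits (ripple addh n x y w) =
    (nat_of_bits x %/ 2 ^ (size n - size w) +
     nat_of_bits y %/ 2 ^ (size n - size w)) %% 2 ^ size w.
  by rewrite /addb gen // subnn !divn1.
elim: w => [|c w IH] wn; first by rewrite !modn1.
rewrite [size (c :: w)]/= (nat_of_bits_div x) (nat_of_bits_div y).
rewrite subnSK // expnS.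
rewrite -[LHS]/(nat_of_bits (addh _ _ (ripple addh n x y w))) /addh.
set X := _ %/ _ in IH *; set Y := nat_of_bits y %/ _ in IH *.
have {}IH := IH (ltnW wn); set a := nth _ _ _; set b := nth _ _ _.
rewrite [LHS]/=; case: ifP => [/andP[-> ->]|ab].
  rewrite nat_of_succb IH size_ripple_addh -addn1 modnDml.
  by rewrite (_ : true + _ + _ = false + (X + Y + 1).*2) ?modn_double //=; lia.
rewrite IH (_ : a + _ + _ = (a (+) b) + (X + Y).*2) ?modn_double //.
by case: a b ab => -[] //=; lia.
Qed.

Lemma nat_of_subb x y : nat_of_bits y <= nat_of_bits x ->
  nat_of_bits (subb x y) = nat_of_bits x - nat_of_bits y.
Proof.
move=> yx; set n := x ++ y.
have small z : nat_of_bits z <= nat_of_bits x ->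
    nat_of_bits z %/ 2 ^ size n = 0.
  move=> zx; rewrite divn_small //; apply: leq_ltn_trans zx _.
  apply: leq_trans (nat_of_bits_lt x) _.
  by rewrite leq_exp2l // size_cat leq_addr.
suff gen w : size w <= size n -> nat_of_bits (ripple subh n x y w) =
    nat_of_bits x %/ 2 ^ (size n - size w) -
    nat_of_bits y %/ 2 ^ (size n - size w).
  by rewrite /subb gen // subnn !divn1.
elim: w => [|c w IH] wn; first by rewrite subn0 !small.
rewrite [size (c :: w)]/=.
have := leq_div2r (2 ^ (size n - (size w).+1)) yx.
rewrite (nat_of_bits_div x) (nat_of_bits_div y).
rewrite subnSK //.
rewrite -[X in _ -> X = _]/(nat_of_bits (subh _ _ (ripple subh n x y w))) /subh.
have {}IH := IH (ltnW wn); have := leq_div2r (2 ^ (size n - size w)) yx.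
set X := nat_of_bits x %/ _ in IH *; set Y := nat_of_bits y %/ _ in IH *.
set a := nth _ _ _; set b := nth _ _ _ => YX h /=.
case: ifP => [/andP[/negbTE a0 b1]|ab]; first last.
  by rewrite IH; case: a b ab h => -[] //=; lia.
(* With digits 0 and 1 at this position, the truncated [x] can dominate the truncated [y] only if Y
   < X, so the higher part of the difference is positive and [predb] is correct on it. *)
move: h; rewrite a0 b1 /= => h; rewrite nat_of_predb IH; lia.
Qed.

Lemma cmpbE x y : cmpb x y =
  if nat_of_bits x == nat_of_bits y then [::]
  else [:: nat_of_bits x < nat_of_bits y].
Proof.
set n := x ++ y.
have sx : nat_of_bits x %/ 2 ^ size n = 0.
  rewrite divn_small // (leq_trans (nat_of_bits_lt x)) //.
  by rewrite leq_exp2l // size_cat leq_addr.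
have sy : nat_of_bits y %/ 2 ^ size n = 0.
  rewrite divn_small // (leq_trans (nat_of_bits_lt y)) //.
  by rewrite leq_exp2l // size_cat leq_addl.
suff gen w : size w <= size n -> ripple cmph n x y w =
    let X := nat_of_bits x %/ 2 ^ (size n - size w) in
    let Y := nat_of_bits y %/ 2 ^ (size n - size w) in
    if X == Y then [::] else [:: X < Y].
  by rewrite /cmpb gen // subnn !divn1.
elim: w => [|c w IH] wn; first by rewrite subn0 sx sy.
rewrite [size (c :: w)]/= (nat_of_bits_div x) (nat_of_bits_div y) subnSK //.
rewrite -[LHS]/(cmph _ _ (ripple cmph n x y w)) IH ?(ltnW wn) //.
set X := _ %/ _; set Y := nat_of_bits y %/ _; rewrite /cmph /=.
set a := nth _ _ _; set b := nth _ _ _.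
case: (eqVneq X Y) => [->|XY].
  rewrite eqn_add2r ltn_add2r; by case: a; case: b.
rewrite ifN; last by case: (a); case: (b); move: XY; lia.
by congr [:: _]; case: (a); case: (b); move: XY; lia.
Qed.

Lemma fp_addb g (X : Type) (ins : seq (X -> seq bool)) n x y :
  fp g ins n -> fp g ins x -> fp g ins y ->
  fp g ins (fun t => addb (n t) (x t) (y t)).
Proof.
apply: fp_ripple => [a c Y ins' z Z|a c z]; last first.
  by rewrite /addh /=; case: ifP; rewrite ?size_succb.
by rewrite /addh; case: (a && c); apply: fp_cons => //; exact: fp_succb.
Qed.

Lemma fp_subb g (X : Type) (ins : seq (X -> seq bool)) x y :
  fp g ins x -> fp g ins y -> fp g ins (fun t => subb (x t) (y t)).
Proof.
move=> U V.
apply: fp_ripple (fp_cat U V) U V => [a c Y ins' z Z|a c z]; last first.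
  by rewrite /subh /=; case: ifP; rewrite ?size_predb.
by rewrite /subh; case: (_ && c); apply: fp_cons => //; exact: fp_predb.
Qed.

Lemma fp_cmpb g (X : Type) (ins : seq (X -> seq bool)) x y :
  fp g ins x -> fp g ins y -> fp g ins (fun t => cmpb (x t) (y t)).
Proof.
move=> U V; apply: fp_ripple (fp_cat U V) U V => [a c Y ins' z Z|a c [|b z]] //.
  apply: fp_ext (fp_case Z (fp_const (if a == c then [::] else [:: c])) Z Z) _.
  by move=> t; rewrite /cmph; case: (z t) => [|[]].
by rewrite /cmph; case: ifP.
Qed.

(** Horner's scheme at the fixed width |x| + |y|, in which the product fits; the fixed width also
    supplies the size bound for [fp_rec]. *)
Definition mulb (x y : seq bool) : seq bool :=
  recn [::] (fun b _ a => addb (x ++ y) (if b then y else [::]) (false :: a)) x.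

Lemma size_mulb x y : size (mulb x y) <= size x + size y.
Proof.
by rewrite /mulb; case: {2}x => //= b w; rewrite size_addb size_cat.
Qed.

Lemma nat_of_mulb x y : nat_of_bits (mulb x y) = nat_of_bits x * nat_of_bits y.
Proof.
rewrite /mulb; set f := fun _ _ _ => _.
suff gen w : size w <= size x ->
    nat_of_bits (recn [::] f w) = nat_of_bits w * nat_of_bits y by exact: gen.
elim: w => //= b w IH wx; rewrite {1}/f nat_of_addb /= IH ?(ltnW wx) //.
rewrite modn_small; first by case: b => /=; lia.
apply: (@leq_trans (2 ^ size (b :: w) * 2 ^ size y)).
  apply: (@leq_ltn_trans (nat_of_bits (b :: w) * nat_of_bits y)).
    by case: b => /=; lia.
  by apply: ltn_mul; exact: nat_of_bits_lt.
by rewrite -expnD leq_exp2l // size_cat leq_add2r.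
Qed.

Lemma fp_mulb g (X : Type) (ins : seq (X -> seq bool)) x y :
  fp g ins x -> fp g ins y -> fp g ins (fun t => mulb (x t) (y t)).
Proof.
move=> U V.
apply: fp_ext (fp_rec (f0 := fun=> [::]) (h := fun b z => addb (x z.1 ++ y z.1)
    (if b then y z.1 else [::]) (false :: z.2.2))
  (B := fun t => size (x t) + size (y t)) U _ _ _ _) _ => //.
- exact: fp_const.
- move=> b; apply: fp_addb; last exact/fp_cons/fp_acc.
    by apply: fp_cat; exact: fp_outer.
  by case: b; [exact: fp_outer|exact: fp_const].
- exact: polybounded_add (fp_polybounded U) (fp_polybounded V).
- by move=> t [|b w] _ //=; rewrite size_addb size_cat.
Qed.

Fixpoint expb (a : seq bool) (k : nat) : seq bool :=
  if k is k'.+1 then mulb a (expb a k') else [:: true].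

Lemma nat_of_expb a k : nat_of_bits (expb a k) = nat_of_bits a ^ k.
Proof. by elim: k => //= k IH; rewrite nat_of_mulb IH expnS. Qed.

Lemma fp_expb g (X : Type) (ins : seq (X -> seq bool)) a k :
  fp g ins a -> fp g ins (fun t => expb (a t) k).
Proof.
move=> A; elim: k => [|k IH] /=; first exact: fp_const.
exact: fp_mulb.
Qed.

Lemma size_expb a k : size (expb a k) <= k * size a + 1.
Proof.
elim: k => //= k IH; apply: leq_trans (size_mulb _ _) _.
by rewrite mulSn -addnA leq_add2l.
Qed.

(** The length of a power is at most linear in the exponent, hence polynomial when the exponent is
    the length of a string. *)
Lemma fp_expb_unary g (X : Type) (ins : seq (X -> seq bool)) a n :
  fp g ins a -> fp g ins n -> fp g ins (fun t => expb (a t) (size (n t))).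
Proof.
move=> A N.
have recE t w :
    recn [:: true] (fun _ _ z => mulb (a t) z) w = expb (a t) (size w).
  by elim: w => //= b w ->.
apply: fp_ext (fp_rec (h := fun b z => mulb (a z.1) z.2.2)
  (B := fun t => size (n t) * size (a t) + 1) N (fp_const [:: true]) _ _ _) _.
- by move=> _; apply: fp_mulb; [exact: fp_outer|exact: fp_acc].
- apply: polybounded_add (polybounded_cst _ _).
  exact: polybounded_mul (fp_polybounded N) (fp_polybounded A).
- move=> t w wn; rewrite recE; apply: leq_trans (size_expb _ _) _.
  by rewrite leq_add2r leq_mul2r wn orbT.
- by move=> t /=; rewrite recE.
Qed.

Definition pow2b (n : nat) : seq bool := rcons (nseq n false) true.

Lemma nat_of_pow2b n : nat_of_bits (pow2b n) = 2 ^ n.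
Proof.
by rewrite /pow2b -cats1 nat_of_bits_cat nat_of_bits_zeros size_nseq /= muln1.
Qed.

Lemma fp_pow2b g (X : Type) (ins : seq (X -> seq bool)) u :
  fp g ins u -> fp g ins (fun x => pow2b (size (u x))).
Proof.
move=> U; apply: fp_ext (fp_cat (fp_nseq false U) (fp_const [:: true])) _.
by move=> x; rewrite cats1.
Qed.

(* Bisection: for p < q, the largest [a] with [q a^k <= p 2^(k (size w))].     *)
Definition rootb (k : nat) (p q : seq bool) : seq bool -> seq bool :=
  recn [::] (fun _ w a =>
    match cmpb (mulb q (expb (true :: a) k))
               (mulb p (expb (pow2b (size w).+1) k))
    with [::] => true :: a | false :: _ => false :: a | true :: _ => true :: a
    end).

Lemma fp_rootb g (X : Type) (ins : seq (X -> seq bool)) k p q u :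
  fp g ins u -> fp g ins (fun x => rootb k p q (u x)).
Proof.
move=> U.
pose h (c : bool) (z : X * (seq bool * seq bool)) :=
  match cmpb (mulb q (expb (true :: z.2.2) k))
             (mulb p (expb (pow2b (size z.2.1).+1) k))
  with [::] => true :: z.2.2 | false :: _ => false :: z.2.2
     | true :: _ => true :: z.2.2 end.
apply: fp_ext (fp_rec (f0 := fun=> [::]) (h := h)
 
  (B := fun x => size (u x)) U _ _ _ _) _ => //.
- exact: fp_const.
- move=> c; have A b : fp g (rec_ins ins) (fun z => b :: z.2.2).
    exact/fp_cons/fp_acc.
  apply: fp_case => //; apply: fp_cmpb; apply: fp_mulb; rewrite ?fp_const //.
  + exact: fp_const.
  + exact: fp_expb.
  + exact: fp_const.
  + apply: fp_expb; exact: (fp_pow2b (fp_cons true fp_tail)).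
- exact: (fp_polybounded U).
- move=> x w; apply: leq_trans.
  by elim: w => //= c w IH; rewrite {1}/h; case: (cmpb _ _) => [|[] ?].
Qed.

(** Doubling the scale adds one binary digit to the root, and it is 1 exactly when 2a + 1 still
    satisfies the inequality. *)
Lemma rootbE k p q c w : let a := nat_of_bits (rootb k p q w) in
  nat_of_bits (rootb k p q (c :: w)) =
  (nat_of_bits q * (a.*2.+1) ^ k <= nat_of_bits p * (2 ^ (size w).+1) ^ k)
  + a.*2.
Proof.
rewrite /= /rootb /= -/(rootb k p q w); set r := rootb _ _ _ w.
rewrite cmpbE !nat_of_mulb !nat_of_expb.
rewrite nat_of_pow2b -[nat_of_bits (true :: r)]/((nat_of_bits r).*2.+1).
by case: ltngtP.
Qed.

(** * Approximable real functions *)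

Definition ratio (R : realType) (n d : seq bool) : R :=
  ((nat_of_bits n)%:R / (nat_of_bits d)%:R)%R.

Definition prec_ins (X : Type) (ins : seq (X -> seq bool)) :
    seq (X * nat -> seq bool) :=
  (fun z => nseq z.2 true) :: [seq i \o fst | i <- ins].

Lemma fp_vars g (X : Type) (pre ins : seq (X -> seq bool)) :
  foldr (fun i => and (fp g (pre ++ ins) i)) True ins.
Proof.
elim: ins pre => //= i ins IH pre; split; last first.
  by rewrite -cat_rcons; exact: IH.
have := @fp_var g _ (pre ++ i :: ins) (size pre).
rewrite size_cat /= nth_cat ltnn subnn /=; apply; lia.
Qed.

Lemma fp_prec g (X : Type) (ins : seq (X -> seq bool)) :
  fp g (prec_ins ins) (fun z => nseq z.2 true).
Proof. exact: (@fp_var g _ (prec_ins ins) 0). Qed.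
Arguments fp_prec {g X ins}.

Lemma fp_fst g (X : Type) (ins : seq (X -> seq bool)) f :
  fp g ins f -> fp g (prec_ins ins) (fun z => f z.1).
Proof. exact: (@fp_lift g _ _ _ _ fst [:: fun z => nseq z.2 true]). Qed.

Local Open Scope ring_scope.

(* The string [a] bounds the precision that is lost when multiplying by [f x]. *)
Definition apx (R : realType) g (X : Type) (ins : seq (X -> seq bool))
    (f : X -> R) : Prop :=
  (exists2 a, fp g ins a & forall x, 0 <= f x <= 2 ^+ size (a x)) /\
  exists n d, [/\ fp g (prec_ins ins) n, fp g (prec_ins ins) d &
    forall z, (0 < nat_of_bits (d z))%N /\
      `|ratio R (n z) (d z) - f z.1| <= 2 ^- z.2].

(** Substitution for the precision: any number of bits computable from the input may be requested,
    to make up for losses in later operations. *)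
Lemma apx_prec (R : realType) g (X : Type) (ins : seq (X -> seq bool))
    (f : X -> R) e :
  apx g ins f -> fp g (prec_ins ins) e ->
  exists n d, [/\ fp g (prec_ins ins) n, fp g (prec_ins ins) d &
    forall z, (0 < nat_of_bits (d z))%N /\
      `|ratio R (n z) (d z) - f z.1| <= 2 ^- size (e z)].
Proof.
move=> [_ [n [d [N D nd]]]] E.
pose h (z : X * nat) := (z.1, size (e z)).
have sub u : fp g (prec_ins ins) u -> fp g (prec_ins ins) (u \o h).
  move=> U; apply: fp_sub U _ => /=; split; first exact: fp_nseq.
  have := fp_vars g [:: fun z => nseq z.2 true] [seq i \o fst | i <- ins].
  rewrite /= -/(prec_ins ins); move: (prec_ins ins) => G.
  by elim: (ins) => //= i l IH [Fi /IH Fl].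
exists (n \o h), (d \o h); split; [exact: sub|exact: sub|].
by move=> z; apply: (nd (h z)).
Qed.

(** * Error propagation in products, quotients and powers *)

Section errors.
Variable R : realType.

Lemma pow2_gt0 n : (0 : R) < 2 ^+ n. Proof. exact: exprn_gt0. Qed.

Lemma pow2_ge1 n : (1 : R) <= 2 ^+ n.
Proof. by apply: exprn_ege1; lra. Qed.

Lemma pow2N_le1 n : (2 : R) ^- n <= 1.
Proof. by rewrite invf_le1 ?pow2_gt0 // pow2_ge1. Qed.

Lemma pow2ND m n : (2 : R) ^- (m + n) = 2 ^- m * 2 ^- n.
Proof. by rewrite exprD invfM. Qed.

Lemma pow2NK n : (2 : R) ^- n * 2 ^+ n = 1.
Proof. by rewrite mulVf // gt_eqF // pow2_gt0. Qed.

Lemma normB_le (a b e : R) : `|a - b| <= e -> b - e <= a <= b + e.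
Proof. by rewrite ler_distl. Qed.

Lemma mul_error (F f H h A B e : R) :
  0 <= f <= A -> 0 <= h <= B -> 1 <= A -> 1 <= B -> 0 <= e <= 1 ->
  `|F - f| <= e -> `|H - h| <= e -> `|F * H - f * h| <= e * (A * B * 2 ^+ 2).
Proof.
move=> /andP[f0 fA] /andP[h0 hB] A1 B1 /andP[e0 e1] Ff Hh.
have -> : F * H - f * h = (F - f) * h + f * (H - h) + (F - f) * (H - h) by ring.
apply: (@le_trans _ _ (e * B + A * e + e * e)); last first.
  rewrite (_ : _ + _ = e * (B + A + e)); last by ring.
  by rewrite ler_wpM2l // (_ : 2 ^+ 2 = 4); [nra|ring].
rewrite (le_trans (ler_normD _ _)) // lerD //; last first.
  by rewrite normrM ler_pM.
by rewrite (le_trans (ler_normD _ _)) // lerD // normrM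
  ?(ger0_norm h0) ?(ger0_norm f0) ler_pM.
Qed.

(** [A] bounds both f and 1/h. The condition on [e] gives e <= h/2, hence H >= h/2, and the
    difference of the quotients has denominator H h >= h^2/2. *)
Lemma div_error (F f H h A e : R) :
  0 <= f <= A -> A^-1 <= h -> 1 <= A -> 0 <= e -> e * (A * 2) <= 1 ->
  `|F - f| <= e -> `|H - h| <= e ->
  0 < H /\ `|F / H - f / h| <= e * (A ^+ 3 * 2 ^+ 2).
Proof.
move=> /andP[f0 fA] hA A1 e0 eA Ff Hh.
have A0 : 0 < A by lra.
have Ah : 1 <= A * h by rewrite -ler_pdivrMl // mulr1.
have h0 : 0 < h by nra.
have eh : e * 2 <= h.
  rewrite (le_trans _ hA) // -[X in _ <= X]mulr1 ler_pdivlMl //; nra.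
have /andP[Hl _] := normB_le Hh.
have H0 : 0 < H by nra.
split=> //.
have -> : F / H - f / h = ((F - f) * h - f * (H - h)) / (H * h).
  by field; rewrite !gt_eqF.
have Hh0 : 0 < H * h by exact: mulr_gt0.
rewrite normrM normfV (gtr0_norm Hh0) ler_pdivrMr //.
apply: (@le_trans _ _ (e * h + A * e)).
  rewrite (le_trans (ler_normB _ _)) // lerD // normrM
    ?(gtr0_norm h0) ?(ger0_norm f0) ler_pM //; exact: ltW.
have H2 : h <= H * 2 by lra.
have : A ^+ 3 * 4 * (H * h) >= h + A.
  have q1 : A ^+ 3 * 4 * (H * h) >= A ^+ 3 * 2 * (h * h).
    rewrite -subr_ge0.
    rewrite (_ : _ - _ = A ^+ 3 * 2 * (h * (H * 2 - h))); last by ring.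
    apply: mulr_ge0; last by apply: mulr_ge0; lra.
    by apply: mulr_ge0 => //; apply/ltW/exprn_gt0.
  have q2 : A ^+ 3 * 2 * (h * h) = A * 2 * (A * h) * (A * h) by ring.
  have q3 : A * 2 * (A * h) * (A * h) >= A * 2 * (A * h).
    by rewrite ler_peMr //; nra.
  have q4 : A * 2 * (A * h) >= A * h + A * h by nra.
  have q5 : h <= A * h by nra.
  have q6 : A <= A * (A * h) by rewrite ler_peMr // ltW.
  have q7 : A * 2 * (A * h) = A * (A * h) + A * (A * h) by ring.
  have q8 : A * h <= A * (A * h) by nra.
  lra.
rewrite (_ : 2 ^+ 2 = 4); last by ring.
by move=> q; nra.
Qed.

(** Peeling off one factor multiplies the error by |F| <= C + 1 and adds at most e f^N, in total
    less than a factor 4C per power. *)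
Lemma exp_error (F f C e : R) N :
  0 <= f <= C -> 1 <= C -> 0 <= e <= 1 -> `|F - f| <= e ->
  `|F ^+ N - f ^+ N| <= e * (C * 2 ^+ 2) ^+ N.
Proof.
move=> /andP[f0 fC] C1 /andP[e0 e1] Ff; rewrite (_ : 2 ^+ 2 = 4); last by ring.
elim: N => [|N IH]; first by rewrite !expr0 subrr normr0 mulr1.
have -> : F ^+ N.+1 - f ^+ N.+1 = F * (F ^+ N - f ^+ N) + f ^+ N * (F - f).
  by rewrite !exprS; ring.
have FC : `|F| <= C + 1.
  have /andP[l u] := normB_le Ff; rewrite ler_norml; apply/andP; split; lra.
have fN : `|f ^+ N| <= (C * 4) ^+ N.
  rewrite normrX (ger0_norm f0) lerXn2r ?nnegrE //; lra.
have C4 : 0 <= (C * 4) ^+ N by apply: exprn_ge0; lra.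
apply: (@le_trans _ _ ((C + 1) * (e * (C * 4) ^+ N) + (C * 4) ^+ N * e)).
  by rewrite (le_trans (ler_normD _ _)) // lerD // normrM ler_pM.
have C4e : 0 <= (C * 4) ^+ N * e by exact: mulr_ge0.
by rewrite exprS; nra.
Qed.

End errors.

Lemma ratioM (R : realType) n d n' d' :
  ratio R (mulb n n') (mulb d d') = ratio R n d * ratio R n' d'.
Proof. by rewrite /ratio !nat_of_mulb !natrM invfM mulrACA. Qed.

Lemma archi_pow2 (R : realType) (c : R) : exists m, c <= 2 ^+ m.
Proof.
exists (Num.bound `|c|); apply: (le_trans (ler_norm c)).
apply: (le_trans (ltW (archi_boundP (normr_ge0 c)))).
by rewrite -natrX ler_nat ltnW // ltn_expl.
Qed.

Lemma apx_ratio (R : realType) g (X : Type) (ins : seq (X -> seq bool)) n d :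
  (0 < nat_of_bits d)%N -> apx g ins (fun=> ratio R n d).
Proof.
move=> d0; split.
  have [m hm] := archi_pow2 (ratio R n d).
  exists (fun=> nseq m true); first exact: fp_const.
  by move=> _; rewrite size_nseq hm andbT divr_ge0.
exists (fun=> n), (fun=> d); split; [exact: fp_const|exact: fp_const|].
by move=> z; split=> //=; rewrite subrr normr0 invr_ge0 exprn_ge0.
Qed.

Lemma apx_mul (R : realType) g (X : Type) (ins : seq (X -> seq bool))
    (f h : X -> R) :
  apx g ins f -> apx g ins h -> apx g ins (fun x => f x * h x).
Proof.
move=> Af Ah; have [[a Fa fa] _] := Af; have [[b Fb hb] _] := Ah.
(* The lengths of [a] and [b] and two more bits cancel the factor A B 2^2 of [mul_error]. *)
pose e z := nseq z.2 true ++ (a z.1 ++ (b z.1 ++ [:: true; true])).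
have Fe : fp g (prec_ins ins) e.
  apply: fp_cat fp_prec _; apply: fp_cat (fp_fst Fa) _.
  exact: fp_cat (fp_fst Fb) (fp_const _).
have [n [d [N D nd]]] := apx_prec Af Fe.
have [n' [d' [N' D' nd']]] := apx_prec Ah Fe.
split.
  exists (fun x => a x ++ b x); first exact: fp_cat.
  move=> x; have /andP[f0 fA] := fa x; have /andP[h0 hB] := hb x.
  by rewrite size_cat exprD mulr_ge0 //= ler_pM.
exists (fun z => mulb (n z) (n' z)), (fun z => mulb (d z) (d' z)).
split; [exact: fp_mulb|exact: fp_mulb|move=> z].
have [d0 err] := nd z; have [d0' err'] := nd' z.
rewrite nat_of_mulb muln_gt0 d0 d0' ratioM; split => //.
have e01 : 0 <= (2 : R) ^- size (e z) <= 1.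
  by rewrite invr_ge0 exprn_ge0 //= pow2N_le1.
apply: le_trans
  (mul_error (fa _) (hb _) (pow2_ge1 _ _) (pow2_ge1 _ _) e01 err err') _.
rewrite /e !size_cat size_nseq -!exprD !pow2ND -mulrA -!pow2ND addnA.
by rewrite pow2NK mulr1.
Qed.

(** [subb] is correct only on a nonnegative difference. As c' < c are constants, fixed extra
    precision beyond the m with 2^-m <= c - c' keeps the approximations in the right order. *)
Lemma apx_subc (R : realType) g (X : Type) (ins : seq (X -> seq bool))
    (c c' : R) : c' < c ->
  apx g ins (fun=> c) -> apx g ins (fun=> c') -> apx g ins (fun=> c - c').
Proof.
move=> cc Ac Ac'; have [[a Fa fa] _] := Ac; have [[a' _ fa'] _] := Ac'.
have [m hm] := archi_pow2 (c - c')^-1.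
have {}hm : 2 ^- m <= c - c'.
  by rewrite -[leRHS]invrK lef_pV2 ?posrE ?exprn_gt0 ?invr_gt0 ?subr_gt0.
pose e (z : X * nat) := nseq z.2 true ++ nseq m.+1 true.
have Fe : fp g (prec_ins ins) e by exact: fp_cat fp_prec (fp_const _).
have [n [d [N D nd]]] := apx_prec Ac Fe.
have [n' [d' [N' D' nd']]] := apx_prec Ac' Fe.
split.
  exists a => // x; have /andP[c0' _] := fa' x; have /andP[_ cA] := fa x.
  by rewrite subr_ge0 ltW //= (le_trans _ cA) // gerBl.
exists (fun z => subb (mulb (n z) (d' z)) (mulb (n' z) (d z))).
exists (fun z => mulb (d z) (d' z)).
split; [|exact: fp_mulb|].
  by apply: fp_subb; exact: fp_mulb.
move=> z; have [d0 err] := nd z; have [d0' err'] := nd' z.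
rewrite nat_of_mulb muln_gt0 d0 d0'; split => //.
have sE : (2 : R) ^- size (e z) = 2 ^- z.2 * 2 ^- m * 2^-1.
  by rewrite /e size_cat !size_nseq -(addn1 m) addnA !pow2ND.
have p1 := pow2N_le1 R z.2; have p2 := pow2N_le1 R m.
have q1 : (0 : R) <= 2 ^- z.2 by rewrite invr_ge0 exprn_ge0.
have q2 : (0 : R) <= 2 ^- m by rewrite invr_ge0 exprn_ge0.
rewrite sE in err err'.
have /andP[l1 u1] := normB_le err; have /andP[l2 u2] := normB_le err'.
have dR : (0 : R) < (nat_of_bits (d z))%:R by rewrite ltr0n.
have dR' : (0 : R) < (nat_of_bits (d' z))%:R by rewrite ltr0n.
have ge :
    (nat_of_bits (mulb (n' z) (d z)) <= nat_of_bits (mulb (n z) (d' z)))%N.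
  rewrite !nat_of_mulb -(ler_nat R) !natrM -ler_pdivrMr // mulrAC.
  rewrite -ler_pdivlMr //.
  apply: (@le_trans _ _ (c' + 2 ^- z.2 * 2 ^- m * 2^-1)) => //.
  apply: (@le_trans _ _ (c - 2 ^- z.2 * 2 ^- m * 2^-1)) => //.
  nra.
have -> : ratio R (subb (mulb (n z) (d' z)) (mulb (n' z) (d z)))
      (mulb (d z) (d' z)) = ratio R (n z) (d z) - ratio R (n' z) (d' z).
  rewrite /ratio nat_of_subb // natrB // !nat_of_mulb !natrM.
  by field; rewrite !gt_eqF.
have -> : ratio R (n z) (d z) - ratio R (n' z) (d' z) - (c - c') =
  (ratio R (n z) (d z) - c) - (ratio R (n' z) (d' z) - c') by ring.
apply: le_trans (ler_normB _ _) _.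
apply: le_trans (lerD err err') _.
nra.
Qed.

Lemma apx_divc (R : realType) g (X : Type) (ins : seq (X -> seq bool))
    (c c' : R) : 0 < c' ->
  apx g ins (fun=> c) -> apx g ins (fun=> c') -> apx g ins (fun=> c / c').
Proof.
move=> c0' Ac Ac'; have [[a _ fa] _] := Ac.
have [i ci] := archi_pow2 c; have [j cj] := archi_pow2 c'^-1.
pose m := (i + j)%N.
have cm : c <= 2 ^+ m.
  by rewrite (le_trans ci) // ler_weXn2l ?leq_addr //; lra.
have cm' : c'^-1 <= 2 ^+ m.
  by rewrite (le_trans cj) // ler_weXn2l ?leq_addl //; lra.
have hm : (2 ^+ m)^-1 <= c'.
  by rewrite -[leRHS]invrK lef_pV2 ?posrE ?exprn_gt0 ?invr_gt0.
(* The 3m + 2 extra bits absorb the factor A^3 2^2 of [div_error] at A = 2^m. *)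
pose e (z : X * nat) := nseq z.2 true ++ nseq (m * 3 + 2) true.
have Fe : fp g (prec_ins ins) e by exact: fp_cat fp_prec (fp_const _).
have [n [d [N D nd]]] := apx_prec Ac Fe.
have [n' [d' [N' D' nd']]] := apx_prec Ac' Fe.
split.
  exists (fun=> nseq (m + m) true); first exact: fp_const.
  move=> x; have /andP[c0 _] := fa x; rewrite size_nseq exprD.
  by rewrite divr_ge0 ?ler_pM // ?invr_ge0 // ltW.
exists (fun z => mulb (n z) (d' z)), (fun z => mulb (d z) (n' z)).
split; [exact: fp_mulb|exact: fp_mulb|].
move=> z; have [d0 err] := nd z; have [d0' err'] := nd' z.
have sE : (2 : R) ^- size (e z) = 2 ^- z.2 * 2 ^- (m * 3 + 2).
  by rewrite /e size_cat !size_nseq pow2ND.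
have e0 : 0 <= (2 : R) ^- size (e z) by rewrite invr_ge0 exprn_ge0.
have e1 : (2 : R) ^- size (e z) * (2 ^+ m * 2) <= 1.
  rewrite -exprSr -[leRHS](pow2NK R (size (e z))) ler_wpM2l //.
  rewrite ler_weXn2l //; first lra.
  by rewrite /e size_cat !size_nseq; lia.
have cb : 0 <= c <= 2 ^+ m by have /andP[-> _] := fa z.1.
have [H0 E] := div_error cb hm (pow2_ge1 R m) e0 e1 err err'.
have dR : (0 : R) < (nat_of_bits (d z))%:R by rewrite ltr0n.
have dR' : (0 : R) < (nat_of_bits (d' z))%:R by rewrite ltr0n.
have n0' : (0 < nat_of_bits (n' z))%N.
  by rewrite -(ltr0n R) -(pmulr_lgt0 _ (_ : 0 < (nat_of_bits (d' z))%:R^-1))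
    ?invr_gt0.
rewrite nat_of_mulb muln_gt0 d0 n0'; split => //.
have -> : ratio R (mulb (n z) (d' z)) (mulb (d z) (n' z)) =
    ratio R (n z) (d z) / ratio R (n' z) (d' z).
  rewrite /ratio !nat_of_mulb !natrM; field.
  by rewrite !gt_eqF // ltr0n.
apply: le_trans E _; rewrite sE -exprM -exprD -mulrA.
by rewrite pow2NK mulr1.
Qed.

Lemma fp_nseq_mul g (X : Type) (ins : seq (X -> seq bool)) k u :
  fp g ins u -> fp g ins (fun x => nseq (k * size (u x)) true).
Proof.
move=> U; elim: k => [|k IH]; first exact: (fp_const [::]).
apply: fp_ext (fp_cat (fp_nseq true U) IH) _ => x.
by rewrite mulSn nseqD.
Qed.

Lemma apx_expc (R : realType) g (X : Type) (ins : seq (X -> seq bool))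
    (c : R) u :
  apx g ins (fun=> c) -> fp g ins u -> apx g ins (fun x => c ^+ size (u x)).
Proof.
move=> Ac U; have [[a _ fa] _] := Ac; have [m cm] := archi_pow2 c.
(* The m + 2 extra bits per factor absorb (C 2^2)^N of [exp_error] at C = 2^m. *)
pose e (z : X * nat) := nseq z.2 true ++ nseq (m.+2 * size (u z.1)) true.
have Fe : fp g (prec_ins ins) e.
  exact: fp_cat fp_prec (fp_nseq_mul _ (fp_fst U)).
have [n [d [N D nd]]] := apx_prec Ac Fe.
split.
  exists (fun x => nseq (m * size (u x)) true); first exact: fp_nseq_mul.
  move=> x; have /andP[c0 _] := fa x.
  by rewrite size_nseq exprM exprn_ge0 //= lerXn2r ?nnegrE ?exprn_ge0.
exists (fun z => expb (n z) (size (u z.1))).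
exists (fun z => expb (d z) (size (u z.1))).
split; [exact: fp_expb_unary N (fp_fst U)|exact: fp_expb_unary D (fp_fst U)|].
move=> z; have [d0 err] := nd z.
rewrite nat_of_expb expn_gt0 d0; split => //.
have -> : ratio R (expb (n z) (size (u z.1))) (expb (d z) (size (u z.1))) =
    ratio R (n z) (d z) ^+ size (u z.1).
  by rewrite /ratio !nat_of_expb !natrX expr_div_n.
have e01 : 0 <= (2 : R) ^- size (e z) <= 1.
  by rewrite invr_ge0 exprn_ge0 //= pow2N_le1.
have cb : 0 <= c <= 2 ^+ m by have /andP[-> _] := fa z.1.
apply: le_trans (exp_error _ cb (pow2_ge1 R m) e01 err) _.
rewrite /e size_cat !size_nseq pow2ND -exprD -exprM addn2 -mulrA.
by rewrite pow2NK mulr1.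
Qed.

Lemma apx_root (R : realType) g (X : Type) (ins : seq (X -> seq bool))
    k p q (t : R) :
  (0 < nat_of_bits q)%N -> (0 < k)%N -> 0 <= t < 1 ->
  t ^+ k = ratio R p q -> apx g ins (fun=> t).
Proof.
move=> q0 k0 /andP[t0 t1] tk; split.
  exists (fun=> [::]); first exact: fp_const.
  by move=> _; rewrite t0 ltW.
exists (fun z => rootb k p q (nseq z.2 true)).
exists (fun z => pow2b (size (nseq z.2 true))).
split; [exact/fp_rootb/fp_prec|exact: fp_pow2b fp_prec|].
move=> [x r] /=; rewrite nat_of_pow2b expn_gt0 size_nseq /ratio; split => //.
have qR : (0 : R) < (nat_of_bits q)%:R by rewrite ltr0n.
(* After [r] bisection steps [rootb] is the integer part of 2^r t. *)
have bound : (nat_of_bits (rootb k p q (nseq r true)))%:R <= 2 ^+ r * t <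
    (nat_of_bits (rootb k p q (nseq r true)))%:R + 1.
  elim: r => [|r /andP[l u]]; first by rewrite /= mul1r t0 add0r.
  rewrite (rootbE k p q true); move: l u; rewrite size_nseq.
  set a := nat_of_bits _ => l u.
  have -> : (nat_of_bits q * a.*2.+1 ^ k <= nat_of_bits p * (2 ^ r.+1) ^ k)%N =
      (a.*2.+1%:R <= 2 ^+ r.+1 * t).
    have e0 : 0 <= 2 ^+ r.+1 * t by rewrite mulr_ge0 ?exprn_ge0.
    rewrite -[in RHS](@ler_pXn2r _ k) ?nnegrE ?ler0n //.
    rewrite -(ler_nat R) !natrM !natrX exprMn tk /ratio mulrA ler_pdivlMr //.
    rewrite mulrC.
    by rewrite [X in _ <= X]mulrC.
  have -> : a.*2.+1%:R = 2 * a%:R + 1 :> R by rewrite -addn1 natrD -mul2n natrM.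
  rewrite exprS -mulrA -mul2n.
  case: (lerP (2 * a%:R + 1) (2 * (2 ^+ r * t))) => h.
    by rewrite natrD natrM /=; apply/andP; split; lra.
  by rewrite add0n natrM; apply/andP; split; lra.
have r0 : (0 : R) < 2 ^+ r by exact: exprn_gt0.
rewrite nat_of_pow2b natrX; set A := (nat_of_bits _)%:R in bound *.
have -> : A / 2 ^+ r - t = (A - 2 ^+ r * t) / 2 ^+ r.
  by field; rewrite gt_eqF.
rewrite normrM normfV (gtr0_norm r0) -[leRHS]mul1r.
rewrite ler_wpM2r ?invr_ge0 ?(ltW r0) //.
by rewrite ler_norml; move: bound => /andP[]; lra.
Qed.

(** * Encodings and NP *)

Lemma apx_pcomputable (R : realType) g (X : Type) (ins : seq (X -> seq bool))
    (d : seq bool -> R) (w : X -> seq bool) a :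
  pcomputable g d -> (forall u, 0 <= d u) ->
  fp g ins (fun x => enc_word (w x)) -> fp g ins a ->
  (forall x, d (w x) <= 2 ^+ size (a x)) ->
  apx g ins (fun x => d (w x)).
Proof.
move=> [dhat [[p [k pk]] dE]] d0 W Fa da; split.
  by exists a => // x; rewrite d0 da.
(* [polytime] gives a final state for each input only existentially; choice makes it a function of
   the input, as [fp_call] requires. *)
have /boolp.choice [v vE] (z : X * nat) : exists v : state,
    runs g p (init [:: enc_word (w z.1); nseq z.2 true])
      ((size (enc_word (w z.1)) + (size (nseq z.2 true) + 0)) ^ k + k)%N v /\
    rep_rat (dhat (w z.1, z.2)) (work v).
  by have [t [v [e tk r]]] := pk (w z.1, z.2); exists v; split => //; exists t.
have run j : fp g (prec_ins ins) (fun z => work (v z) j).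
  apply: (@fp_call _ _ _ _ _ p (fun z => (size (enc_word (w z.1)) +
    (size (nseq z.2 true) + 0)) ^ k + k)%N v j (fp_fst W) fp_prec) => [|z].
    apply: polybounded_add (polybounded_cst _ _).
    apply: (polybounded_comp (h := fun z => size (enc_word (w z.1)) +
      (size (nseq z.2 true) + 0)) (f := fun n => n ^ k) (t := id))%N.
      by exists k => n; apply/leq_expn/leq_addr.
    apply: polybounded_add (fp_polybounded (fp_fst W)) _.
    apply: polybounded_add (polybounded_cst _ _).
    exact: (fp_polybounded fp_prec).
  by have [] := vE z.
(* A negative approximation is replaced by 0, which is no farther from the nonnegative value of
   [d]. *)
pose n z := match work (v z) 0%N with
  | [::] => work (v z) 1%N | false :: _ => work (v z) 1%N
  | true :: _ => [::] end.
exists n, (fun z => work (v z) 2%N); split => //.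
  by apply: fp_case => //; exact: (fp_const [::]).
move=> z; have [_ [sgn [v0 v2 q]]] := vE z; split => //.
have := dE (w z.1) z.2; rewrite q /n v0 /ratio.
rewrite rmorphM fmorphV rmorphM rmorph_sign /= !ratr_nat.
case: sgn {v0 q} => /=; last by rewrite expr0 mul1r.
set N := _%:R; set D := _%:R.
have N0 : 0 <= N / D by rewrite divr_ge0.
rewrite mul0r sub0r normrN (ger0_norm (d0 _)); apply: le_trans.
rewrite expr1 mulN1r mulNr -opprD normrN ger0_norm ?lerDr //.
exact: addr_ge0.
Qed.

Lemma pcomputable_apx (R : realType) g (Sigma : finType)
    (d : seq Sigma -> R) :
  apx g [:: @enc_word Sigma] d -> pcomputable g d.
Proof.
move=> [_ [n [D [Fn FD nD]]]].
exists (fun z => (nat_of_bits (n z))%:R / (nat_of_bits (D z))%:R).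
split; last first.
  move=> w r; have [_] := nD (w, r).
  by rewrite rmorphM fmorphV /= !ratr_nat.
(* [prec_ins] lists the precision first, while [enc_word_unary] puts the word on stack 0 and the
   precision on stack 1. *)
have [//|//|P [T [polyT runP]]] := Fn [:: 1; 0]%N 2%N.
have [//|//|Q [V [polyV runQ]]] := FD [:: 1; 0]%N 3%N.
pose s (z : seq Sigma * nat) := sumn [seq size i | i <- enc_word_unary z].
pose F z := (T z + (V z + ((2 * size (enc_word z.1)).+1 +
  ((2 * size (nseq z.2 true)).+1 + (1 + ((8 * size (n z) + 2) +
  (8 * size (D z) + 2)))))))%N.
have toS h : polybounded (sizes (prec_ins [:: @enc_word Sigma])) h ->
    polybounded s h.
  move=> ph; apply: (polybounded_comp (h := id) ph).
  by apply: polybounded_le (polybounded_size s) => z; rewrite /sizes /s /=; lia.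
have polyF : polybounded s F.
  have lin c e h : polybounded s h -> polybounded s (fun z => c * h z + e)%N.
    move=> ph; apply: polybounded_add (polybounded_cst _ _).
    exact: polybounded_mul (polybounded_cst _ _) ph.
  apply: polybounded_add; first exact: toS.
  apply: polybounded_add; first exact: toS.
  apply: polybounded_add.
    apply: polybounded_le (lin 2%N 1%N _ (polybounded_size s)) => z.
    by rewrite /s /=; lia.
  apply: polybounded_add.
    apply: polybounded_le (lin 2%N 1%N _ (polybounded_size s)) => z.
    by rewrite /s /=; lia.
  apply: polybounded_add; first exact: polybounded_cst.
  apply: polybounded_add; apply: lin; apply: toS.
    exact: (fp_polybounded Fn).
  exact: (fp_polybounded FD).
have [k Fk] := exp_of_polybounded polyF.
exists (Seq P (Seq Q (Seq (clear 0) (Seq (clear 1) (Seq (Push false 0)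
  (Seq (mv 2 1 4) (mv 3 2 4))))))), k.
move=> z; pose u0 := init (enc_word_unary z).
have c2 : clean 2 u0 by split => // -[|[|i]] //= _; rewrite nth_nil.
have run1 := runP z u0 c2 erefl.
have run2 := runQ z _ (clean_setstack (n z) c2) erefl.
pose u2 := setstack (setstack u0 2 (n z)) 3 (D z).
have run3 := runs_clear g 0 u2.
pose u3 := setstack u2 0 [::].
have run4 := runs_clear g 1 u3.
pose u4 := setstack u3 1 [::].
have run5 := runs_push g false 0 u4.
pose u5 := setstack u4 0 [:: false].
have run6 := @runs_mv g 2 1 4 u5 isT isT isT erefl erefl.
pose u6 := setstack (setstack u5 1 (n z)) 2 [::].
have run7 := @runs_mv g 3 2 4 u6 isT isT isT erefl erefl.
have [t tF e] := runs_seq run1 (runs_seq run2 (runs_seq run3 (runs_seq run4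
  (runs_seq run5 (runs_seq run6 run7))))).
eexists t, _; split; first exact: e.
  exact: leq_trans tF (Fk z).
have [D0 _] := nD z.
by exists false; split => //=; rewrite expr0 mul1r.
Qed.

Lemma enum_rankE (T : finType) (a : T) : enum_rank a = index a (enum T) :> nat.
Proof.
rewrite -{2}(nth_enum_rank a a) index_uniq ?enum_uniq //.
by rewrite -cardE ltn_ord.
Qed.

(** [true] comes first in the enumeration of [bool], so the letter 1 has the shorter codeword. *)
Lemma enc_word_bool (w : seq bool) b :
  enc_word (b :: w) =
  (if b then [:: false] else [:: true; false]) ++ enc_word w.
Proof.
rewrite /enc_word /= enum_rankE; congr (_ ++ _).
by rewrite enumT unlock; case: b.
Qed.

Lemma enc_word_option (w : seq (option bool)) b :
  enc_word (b :: w) =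
  (match b with None => [:: false] | Some true => [:: true; false]
    | Some false => [:: true; true; false] end) ++ enc_word w.
Proof.
rewrite /enc_word /= enum_rankE; congr (_ ++ _).
rewrite enumT unlock /= /option_enum.
by rewrite unlock; case: b => [[]|].
Qed.

(* A codeword [1^i 0] is read from its right end: [0] announces the letter 0,  *)
(* which the preceding 1, if any, turns into a nonzero letter.                 *)
Definition abs_enc : seq bool -> seq bool :=
  recn [::] (fun b w a =>
    if b then (match w with false :: _ => behead a | _ => a end)
    else [:: true, false & a]).

Definition zeros_enc : seq bool -> seq bool :=
  recn [::] (fun b w a =>
    if b then (match w with false :: _ => behead a | _ => a end)
    else true :: a).

Definition nonzeros_enc : seq bool -> seq bool :=
  recn [::] (fun b w a =>
    if b then (match w with false :: _ => true :: a | _ => a end) else a).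

Lemma abs_encE (w : seq (option bool)) :
  abs_enc (enc_word w) = enc_word (map isSome w).
Proof.
elim: w => // a w IH; rewrite enc_word_option map_cons enc_word_bool -IH.
by case: a => [[]|].
Qed.

Lemma zeros_encE (w : seq (option bool)) :
  size (zeros_enc (enc_word w)) = count (fun a => ~~ isSome a) w.
Proof.
by elim: w => // a w IH; rewrite enc_word_option /= -IH; case: a => [[]|].
Qed.

Lemma nonzeros_encE (w : seq (option bool)) :
  size (nonzeros_enc (enc_word w)) = count isSome w.
Proof.
by elim: w => // a w IH; rewrite enc_word_option /= -IH; case: a => [[]|].
Qed.

Section decode.
Variables (g : seq bool -> seq bool) (X : Type) (ins : seq (X -> seq bool)).
Variables (u : X -> seq bool) (U : fp g ins u).

Let A : fp g (rec_ins ins) (fun z => z.2.2) := fp_acc.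
Let W : fp g (rec_ins ins) (fun z => z.2.1) := fp_tail.

Lemma fp_abs_enc : fp g ins (fun x => abs_enc (u x)).
Proof.
pose h (b : bool) (z : X * (seq bool * seq bool)) :=
  if b then (match z.2.1 with [::] => z.2.2 | false :: _ => behead z.2.2
             | true :: _ => z.2.2 end)
  else [:: true, false & z.2.2].
apply: fp_ext (fp_rec (f0 := fun=> [::]) (h := h)
  (B := fun x => 2 * size (u x))%N U _ _ _ _) _ => //.
- exact: fp_const.
- case; last by do 2!apply: fp_cons.
  by apply: fp_case => //; exact: fp_behead.
- exact: polybounded_mul (polybounded_cst _ _) (fp_polybounded U).
- move=> x w /(leq_mul (leqnn 2)); apply: leq_trans.
  elim: w => //= -[] w IH; rewrite {1}/h /=; last by lia.
  by case: w IH => [|[] w] //=; rewrite ?size_behead; lia.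
Qed.

Lemma fp_zeros_enc : fp g ins (fun x => zeros_enc (u x)).
Proof.
pose h (b : bool) (z : X * (seq bool * seq bool)) :=
  if b then (match z.2.1 with [::] => z.2.2 | false :: _ => behead z.2.2
             | true :: _ => z.2.2 end)
  else true :: z.2.2.
apply: fp_ext (fp_rec (f0 := fun=> [::]) (h := h)
  (B := fun x => size (u x))%N U _ _ _ _) _ => //.
- exact: fp_const.
- case; last by apply: fp_cons.
  by apply: fp_case => //; exact: fp_behead.
- exact: (fp_polybounded U).
- move=> x w; apply: leq_trans.
  elim: w => //= -[] w IH; rewrite {1}/h //=.
  by case: w IH => [|[] w] //=; rewrite ?size_behead; lia.
Qed.

Lemma fp_nonzeros_enc : fp g ins (fun x => nonzeros_enc (u x)).
Proof.
pose h (b : bool) (z : X * (seq bool * seq bool)) :=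
  if b then (match z.2.1 with [::] => z.2.2 | false :: _ => true :: z.2.2
             | true :: _ => z.2.2 end)
  else z.2.2.
apply: fp_ext (fp_rec (f0 := fun=> [::]) (h := h)
  (B := fun x => size (u x))%N U _ _ _ _) _ => //.
- exact: fp_const.
- case; last exact: A.
  by apply: fp_case => //; exact: fp_cons.
- exact: (fp_polybounded U).
- move=> x w; apply: leq_trans.
  elim: w => //= -[] w IH; rewrite {1}/h /=; last by lia.
  by case: w IH => [|[] w] //=; lia.
Qed.

End decode.

Lemma size_enc_word_ge (w : seq (option bool)) : (size w <= size (enc_word w))%N.
Proof.
elim: w => // a w IH; rewrite enc_word_option size_cat.
by case: a => [[]|] /=; lia.
Qed.

Local Open Scope nat_scope.

(** * Deciders and closure properties of NP *)

Lemma fp_polytime (V : seq bool * seq bool -> bool) :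
  fp no_oracle [:: fst; snd] (fun z => [:: V z]) ->
  polytime no_oracle enc_strings rep_bool V.
Proof.
move=> F; have [//|//|P [T [polyT runP]]] := F [:: 0; 1] 2.
pose s (z : seq bool * seq bool) := sumn [seq size i | i <- enc_strings z].
have polyS : polybounded s (fun z => T z + ((2 * size z.1).+1 + 10)).
  apply: polybounded_add => //.
  apply: (polybounded_le (h := fun z => 2 * s z + 11)).
    by move=> z; rewrite /s /=; lia.
  apply: polybounded_add (polybounded_cst _ _).
  exact: polybounded_mul (polybounded_cst _ _) (polybounded_size _).
have [k Tk] := exp_of_polybounded polyS.
exists (Seq P (Seq (clear 0) (mv 2 0 3))), k => z.
pose u0 := init (enc_strings z).
have c2 : clean 2 u0 by split => // -[|[|i]] //= _; rewrite nth_nil.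
have run1 := runP z u0 c2 erefl.
have run2 := runs_clear no_oracle 0 (setstack u0 2 [:: V z]).
have run3 := @runs_mv no_oracle 2 0 3
  (setstack (setstack u0 2 [:: V z]) 0 [::]) isT isT isT erefl erefl.
have [t tT e] := runs_seq run1 (runs_seq run2 run3).
by eexists t, _; split; [exact: e|exact: leq_trans tT (Tk z)|].
Qed.

Lemma fp_decider (X : Type) (ins : seq (X -> seq bool)) V e1 e2 :
  polytime no_oracle enc_strings rep_bool V ->
  fp no_oracle ins e1 -> fp no_oracle ins e2 ->
  fp no_oracle ins (fun x => [:: V (e1 x, e2 x)]).
Proof.
move=> [p [k pV]] E1 E2.
have /boolp.choice [v vE] (x : X) : exists v : state,
    runs no_oracle p (init [:: e1 x; e2 x])
      ((size (e1 x) + (size (e2 x) + 0)) ^ k + k) v /\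
    work v 0 = [:: V (e1 x, e2 x)].
  by have [t [v [e tk r]]] := pV (e1 x, e2 x); exists v; split => //; exists t.
apply: fp_ext (@fp_call _ _ _ _ _ p (fun x => (size (e1 x) +
    (size (e2 x) + 0)) ^ k + k) v 0 E1 E2 _ _) _ => [|x|x].
- apply: polybounded_add (polybounded_cst _ _).
  apply: (polybounded_comp (h := fun x => size (e1 x) +
      (size (e2 x) + 0)) (f := fun n => n ^ k) (t := id)).
    by exists k => n; apply/leq_expn/leq_addr.
  apply: polybounded_add (fp_polybounded E1) _.
  exact: polybounded_add (fp_polybounded E2) (polybounded_cst _ _).
- by have [] := vE x.
- by have [] := vE x.
Qed.

Lemma fp_nseq_exp g (X : Type) (ins : seq (X -> seq bool)) u k :
  fp g ins u -> fp g ins (fun x => nseq (size (u x) ^ k + k) true).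
Proof.
move=> U; suff E : fp g ins (fun x => nseq (size (u x) ^ k) true).
  by apply: fp_ext (fp_cat E (fp_const (nseq k true))) _ => x; rewrite nseqD.
elim: k => [|k IH]; first exact: (fp_const [:: true]).
have recE n w :
    recn [::] (fun _ _ a => nseq n true ++ a) w = nseq (size w * n) true.
  by elim: w => //= c w ->; rewrite mulSn nseqD.
apply: fp_ext (fp_rec (f0 := fun=> [::])
  (h := fun _ z => nseq (size (u z.1) ^ k) true ++ z.2.2)
  (B := fun x => size (u x) * size (nseq (size (u x) ^ k) true))
  U _ _ _ _) _ => //.
- exact: fp_const.
- by move=> _; exact: fp_cat (fp_outer IH) fp_acc.
- exact: polybounded_mul (fp_polybounded U) (fp_polybounded IH).
- by move=> x w wu; rewrite /= recE !size_nseq leq_mul2r wu orbT.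
- by move=> x; rewrite /= recE expnS.
Qed.

(** These are the empty and the full language, which supply the hypothesis of
    [beta_gale_independent]. *)
Lemma NP_const (b : bool) : NP [set _ | b]%classic.
Proof.
exists (fun=> b), 0; split; first exact: (fp_polytime (fp_const [:: b])).
by move=> x; split=> [h|[y []]//]; exists [::].
Qed.

(* The first bit of a witness says which of the two languages it is for; the   *)
(* rest must respect the length bound of that language.                        *)
Lemma NP_union (A B : set (seq bool)) : NP A -> NP B -> NP (A `|` B)%classic.
Proof.
move=> [V1 [k1 [t1 A1]]] [V2 [k2 [t2 B2]]].
pose short k (z : seq bool * seq bool) :=
  size (behead z.2) <= size z.1 ^ k + k.
pose V (z : seq bool * seq bool) :=
  match z.2 with [::] => false
  | true :: y => short k1 z && V1 (z.1, y)
  | false :: y => short k2 z && V2 (z.1, y) end.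
pose k := k1 + k2 + 2.
(* The inequality is strict to leave room for the tag bit. *)
have kle (x : seq bool) i : i <= k1 + k2 -> size x ^ i + i < size x ^ k + k.
  move=> ik; have [x0|x0] := posnP (size x).
    by rewrite x0; case: i ik => [|i] ik; rewrite ?expn0 ?exp0n // /k; lia.
  have : size x ^ i <= size x ^ k by rewrite leq_pexp2l // /k; lia.
  by rewrite /k; lia.
exists V, k; split; last first.
  move=> x; split=> [[/A1|/B2] [y [sy Vy]]|[[|[] y] [sy]] //].
  - exists (true :: y); rewrite /V /short /= sy; split => //.
    by apply: leq_ltn_trans sy _; apply: kle; lia.
  - exists (false :: y); rewrite /V /short /= sy; split => //.
    by apply: leq_ltn_trans sy _; apply: kle; lia.
  - by rewrite /V /short /= => /andP[sy1 Vy]; left; apply/A1; exists y.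
  - by rewrite /V /short /= => /andP[sy1 Vy]; right; apply/B2; exists y.
apply: fp_polytime; set ins := [:: fst; snd].
have F1 : fp no_oracle ins fst by exact: (@fp_var _ _ ins 0).
have F2 : fp no_oracle ins snd by exact: (@fp_var _ _ ins 1).
have check i W : polytime no_oracle enc_strings rep_bool W ->
    fp no_oracle ins (fun z => [:: short i z && W (z.1, behead z.2)]).
  move=> tW; have := fp_case
    (fp_drop (fp_nseq_exp i F1) (fp_behead F2))
    (fp_decider tW F1 (fp_behead F2))
    (fp_const [:: false]) (fp_const [:: false]).
  (* The witness is short enough exactly when dropping as many bits as the bound allows leaves
     nothing. *)
  move=> /fp_ext; apply => z; rewrite size_nseq /short -subn_eq0 -size_drop.
  by case: drop => [|[]].
have := fp_case F2 (fp_const [:: false]) (check k2 V2 t2) (check k1 V1 t1).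
by move=> /fp_ext; apply => -[x [|[] y]].
Qed.

(** * Gales for the biased coin *)

Local Open Scope classical_set_scope.
Local Open Scope ring_scope.

Lemma le_limn_esup (R : realType) (u v : nat -> R) : (forall n, u n <= v n) ->
  (limn_esup (fun n => (u n)%:E) <= limn_esup (fun n => (v n)%:E))%E.
Proof.
move=> uv; apply: le_ereal_inf_tmp => _ [V FV <-].
apply: (@le_trans _ _ (ereal_sup [set (u n)%:E | n in V])).
  by apply: ereal_inf_lbound; exists V.
apply: ge_ereal_sup => _ [n Vn <-].
apply: (@le_trans _ _ (v n)%:E); first by rewrite lee_fin.
by apply: ereal_sup_ubound; exists n.
Qed.

Lemma succeeds_unbounded (R : realType) (Sigma : finType)
    (d : seq Sigma -> R) S C :
  succeeds d S -> ~ (forall n, d (mkseq S n) <= C).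
Proof.
move=> dS dC; have := le_limn_esup dC; rewrite [leLHS]dS leye_eq => /eqP.
rewrite is_cvg_limn_esupE; last exact: is_cvg_cst.
by rewrite lim_cst.
Qed.

Lemma powR_expn (R : realType) (a r : R) n : 0 <= a ->
  (a `^ r) ^+ n = a `^ (r * n%:R).
Proof. by move=> a0; rewrite powRrM powR_mulrn ?powR_ge0. Qed.

Section beta_gale.
Variables (R : realType) (s : R) (d : seq bool -> R).
Hypotheses (s_lt1 : s < 1) (gale_d : gale (beta_distr R) s d).

Let x : R := (1 / 4) `^ s.
Let y : R := (3 / 4) `^ s.

Lemma powR_quarter_ge : 1 / 4 <= x.
Proof. by apply: ger1_powR; [lra|exact: ltW]. Qed.

Lemma powR_three_quarters_ge : 3 / 4 <= y.
Proof. by apply: ger1_powR; [lra|exact: ltW]. Qed.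

Lemma beta_galeE w : d w = d (rcons w false) * x + d (rcons w true) * y.
Proof. by rewrite (gale_d.2 w) big_bool addrC. Qed.

Lemma beta_gale_ge0 w : 0 <= d w.
Proof. exact: gale_d.1. Qed.

Lemma beta_gale_rcons w b : d (rcons w b) <= 4 * d w.
Proof.
have := beta_galeE w; have := powR_quarter_ge; have := powR_three_quarters_ge.
have := beta_gale_ge0 (rcons w false); have := beta_gale_ge0 (rcons w true).
by case: b; nra.
Qed.

(** As both weights are at least 1/4, the capital at most quadruples per letter. This gives [apx]
    its power of 2 with a computable unary exponent. *)
Lemma beta_gale_bound w : d w <= d [::] * 2 ^+ (size w + size w).
Proof.
elim/last_ind: w => [|w b IH]; first by rewrite mulr1.
apply: le_trans (beta_gale_rcons w b) _.
rewrite size_rcons addSn addnS !exprS.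
rewrite (_ : d [::] * _ = 4 * (d [::] * 2 ^+ (size w + size w))); last by ring.
by rewrite ler_pM2l.
Qed.

(* Otherwise the bets would not depend on the position, and no such bets can   *)
(* win both against the empty set and against the full one.                    *)
Lemma beta_gale_independent :
  (forall b, succeeds d (fun=> b)) ->
  exists u v, d (rcons v false) * d (rcons u true) <
              d (rcons u false) * d (rcons v true).
Proof.
move=> succ_d; apply: contrapT => dep.
have {}dep u v : d (rcons u false) * d (rcons v true) =
    d (rcons v false) * d (rcons u true).
  apply/eqP; rewrite eq_le.
  apply/andP; split; rewrite leNgt; apply/negP => lt_uv.
    by apply: dep; exists u, v.
  by apply: dep; exists v, u.
have x0 : 0 < x by have := powR_quarter_ge; lra.
have y0 : 0 < y by have := powR_three_quarters_ge; lra.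
pose D := d [::]; pose a := d [:: false]; pose b := d [:: true].
have DE : D = a * x + b * y by exact: (beta_galeE [::]).
have D0 : 0 < D.
  rewrite lt_neqAle beta_gale_ge0 andbT; apply/negP => /eqP D0.
  apply: (succeeds_unbounded (C := 0) (succ_d false)) => n.
  elim: n => [|n IH]; first by rewrite -[d _]/D -D0.
  by rewrite mkseqS; apply: le_trans (beta_gale_rcons _ _) _; lra.
have a0 : 0 <= a := beta_gale_ge0 _.
have b0 : 0 <= b := beta_gale_ge0 _.
(* Comparison with the empty word: every node splits its capital in the proportion a : b. *)
have prop u : d (rcons u false) * b = a * d (rcons u true) := dep u [::].
have step0 u : D * d (rcons u false) = a * d u.
  rewrite (beta_galeE u) DE; transitivity
    (a * x * d (rcons u false) + y * (d (rcons u false) * b)); first by ring.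
  by rewrite prop; ring.
have step1 u : D * d (rcons u true) = b * d u.
  rewrite (beta_galeE u) DE; transitivity
    (x * (a * d (rcons u true)) + b * y * d (rcons u true)); first by ring.
  by rewrite -prop; ring.
(* Along a constant sequence the capital is multiplied by e/D at each step, so it stays bounded if e
   <= D. *)
have grow c e : (forall u, D * d (rcons u c) = e * d u) -> D < e.
  move=> step; rewrite ltNge; apply/negP => eD.
  apply: (succeeds_unbounded (C := D) (succ_d c)) => n.
  elim: n => [|n IH] //; rewrite mkseqS.
  apply: le_trans IH; rewrite -(ler_pM2l D0) step.
  by rewrite ler_wpM2r // beta_gale_ge0.
(* Success on both constant sequences gives a > D and b > D, whereas D = a x + b y with x + y >=
   1. *)
have := grow _ _ step0; have := grow _ _ step1.
have := powR_quarter_ge; have := powR_three_quarters_ge.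
by move: DE; nra.
Qed.

End beta_gale.

(** * Lifting the gale to pairs *)

Lemma sum_option_bool (R : realType) (F : option bool -> R) :
  \sum_a F a = F None + (F (Some true) + F (Some false)).
Proof.
rewrite (bigD1 None) //= (reindex_omap Some id) => [|[]//].
by rewrite (eq_bigl xpredT) => [|a]; rewrite ?big_bool ?eqxx.
Qed.

Definition lift_gale (R : realType) (d : seq bool -> R) (A B : R)
    (w : seq (option bool)) : R :=
  d (map isSome w) *
  (A ^+ count (fun a => ~~ isSome a) w * B ^+ count isSome w).

(** The letter 0 carries the [false] branch of [d], and both nonzero letters share the [true]
    branch, whence the factor 2 in the equation for B. *)
Lemma gale_lift (R : realType) (s s' : R) (d : seq bool -> R) (A B : R) :
  gale (beta_distr R) s d -> 0 <= A -> 0 <= B ->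
  A * (1 / 4) `^ s' = (1 / 4) `^ s ->
  B * (3 / 8) `^ s' * 2 = (3 / 4) `^ s ->
  gale (gamma0_distr R) s' (lift_gale d A B).
Proof.
move=> [d0 dE] A0 B0 eA eB; split=> w.
  by rewrite /lift_gale mulr_ge0 ?mulr_ge0 ?exprn_ge0.
rewrite sum_option_bool /lift_gale !map_rcons -!cats1 !count_cat /= dE big_bool.
rewrite /= -!cats1 !addn0 !addn1 !exprS -eA -eB; ring.
Qed.

Lemma lift_gale_ge (R : realType) (d : seq bool -> R) (A B : R) w :
  (forall u, 0 <= d u) -> 1 <= A -> 1 <= B ->
  d (map isSome w) <= lift_gale d A B w.
Proof.
move=> d0 A1 B1; rewrite /lift_gale -[leLHS]mulr1 ler_wpM2l //.
by rewrite -[leLHS]mul1r ler_pM ?exprn_ege1.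
Qed.

Lemma pair_seq_union (AB : set (seq bool) * set (seq bool)) n :
  map isSome (mkseq (pair_seq AB) n) = mkseq (lang_seq (AB.1 `|` AB.2)) n.
Proof.
rewrite /mkseq -map_comp; apply: eq_map => i /=.
rewrite /pair_seq /lang_seq asbool_or.
by case: asboolP => //= _; case: asboolP.
Qed.

Lemma lift_succeeds (R : realType) (d : seq bool -> R) (A B : R) AB :
  (forall u, 0 <= d u) -> 1 <= A -> 1 <= B ->
  succeeds d (lang_seq (AB.1 `|` AB.2)) ->
  succeeds (lift_gale d A B) (pair_seq AB).
Proof.
move=> d0 A1 B1 dS; apply/eqP; rewrite -leye_eq -dS.
by apply: le_limn_esup => n; rewrite -pair_seq_union lift_gale_ge.
Qed.

Lemma powR_root (R : realType) (a : R) k : 0 <= a -> (0 < k)%N ->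
  (a `^ k%:R^-1) ^+ k = a.
Proof.
by move=> a0 k0; rewrite powR_expn // mulVf ?pnatr_eq0 ?gtn_eqF // powRr1.
Qed.

Lemma powR_lt1 (R : realType) (a r : R) :
  0 <= a < 1 -> 0 < r -> 0 <= a `^ r < 1.
Proof.
move=> /andP[a0 a1] r0; rewrite powR_ge0 /=.
have <- : 1 `^ r = 1 :> R by rewrite powR1.
by rewrite gt0_ltr_powR // nnegrE.
Qed.

Lemma powR_1B (R : realType) (a r : R) : 0 < a -> a `^ (1 - r) * a `^ r = a.
Proof. move=> a0; rewrite -powRD ?lt0r_neq0 ?implybT //.
by rewrite subrK powRr1 // ltW. Qed.

(* The two quantities are the factors A and B for the exponent s' = 1 - 1/k.   *)
Lemma lift_exponent (R : realType) (s : R) : s < 1 ->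
  exists2 k, (0 < k)%N &
    1 <= 4 * ((1 / 4) `^ k%:R^-1 * (1 / 4) `^ s) /\
    1 <= 4 / 3 * ((3 / 8) `^ k%:R^-1 * (3 / 4) `^ s).
Proof.
(* The first bound needs only (1-s) k >= 1. For the second, B^k = 3/8 (4/3)^((1-s) k), and 3/8
   (4/3)^4 = 32/27 > 1, whence the 4. *)
move=> s1; pose k := (Num.bound (4 / (1 - s))).+1.
have k0 : (0 : R) < k%:R by rewrite ltr0n.
have sk : 4 <= (1 - s) * k%:R.
  rewrite -ler_pdivrMl ?subr_gt0 // mulrC.
  have p : 0 <= 4 / (1 - s) by rewrite divr_ge0 // subr_ge0 ltW.
  by apply: le_trans (ltW (archi_boundP p)) _; rewrite ler_nat.
exists k => //; split.
  have q14 : (1 / 4 : R) != 0 by apply: lt0r_neq0; lra.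
  rewrite -powRD ?q14 ?implybT //.
  suff : (1 / 4) `^ 1 <= (1 / 4) `^ (k%:R^-1 + s) :> R.
    by rewrite powRr1; lra.
  apply: ger_powR; first lra.
  rewrite -lerBrDr -[leLHS]mul1r ler_pdivrMr //; lra.
have B0 : 0 <= 4 / 3 * ((3 / 8) `^ k%:R^-1 * (3 / 4) `^ s) :> R.
  by rewrite mulr_ge0 ?mulr_ge0 ?powR_ge0; lra.
have r38 : (3 / 8 : R) `^ k%:R^-1 ^+ k = 3 / 8 by apply: powR_root; [lra|].
have q34 : (3 / 4 : R) != 0 by apply: lt0r_neq0; lra.
have p34 : (0 : R) <= 3 / 4 by lra.
have e43 : (4 / 3 : R) = (3 / 4) `^ (-1).
  by rewrite powR_inv1; [field|lra].
rewrite -(@ler_pXn2r _ k) ?nnegrE // expr1n e43 !(exprMn, r38) !powR_expn //.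
rewrite mulrCA -powRD ?q34 ?implybT //.
have : (3 / 4) `^ (- (4%:R)) <= (3 / 4) `^ (- 1 * k%:R + s * k%:R) :> R.
  by apply: ger_powR; lra.
rewrite powRN powR_mulrn; last lra.
have -> : ((3 / 4) ^+ 4)^-1 = 256 / 81 :> R by field.
by move: (_ `^ _) => P; lra.
Qed.

(** Only [d (map isSome w)] and the two exponents depend on the input. The bases are constants:
    (1/4)^s and (3/4)^s come from values of [d], the k-th roots from bisection. The words [u] and
    [v] and the bounds on constants are hardwired. *)
Lemma apx_lift_gale (R : realType) g (s : R) (d : seq bool -> R) k :
  s < 1 -> (0 < k)%N -> gale (beta_distr R) s d -> pcomputable g d ->
  (forall b, succeeds d (fun=> b)) ->
  pcomputable g (lift_gale d (4 * ((1 / 4) `^ k%:R^-1 * (1 / 4) `^ s))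
                             (4 / 3 * ((3 / 8) `^ k%:R^-1 * (3 / 4) `^ s))).
Proof.
move=> s1 k0 gd cd succ_d; apply: pcomputable_apx.
set ins := [:: _]; have d0 := gd.1.
have F : fp g ins (@enc_word (option bool)) by exact: (@fp_var _ _ ins 0).
have [m hm] := archi_pow2 (d [::]).
have W : apx g ins (fun w => d (map isSome w)).
  apply: (apx_pcomputable cd d0
    (a := fun w => nseq m true ++ (enc_word w ++ enc_word w))).
  - by apply: fp_ext (fp_abs_enc F) _ => w; rewrite abs_encE.
  - apply: fp_cat (fp_const _) _; exact: fp_cat.
  - move=> w; apply: le_trans (beta_gale_bound s1 gd _) _.
    rewrite !size_cat size_nseq size_map (exprD _ m) ler_pM ?exprn_ge0 //.
    by rewrite ler_weXn2l ?leq_add ?size_enc_word_ge //; lra.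
have C v : apx g ins (fun=> d v).
  have [n hn] := archi_pow2 (d v).
  apply: (apx_pcomputable (a := fun=> nseq n true) (w := fun=> v) cd d0).
  - exact: fp_const.
  - exact: fp_const.
  - by move=> _; rewrite size_nseq.
have [u [v uv]] := beta_gale_independent s1 gd succ_d.
have eu := beta_galeE gd u; have ev := beta_galeE gd v.
have xge := powR_quarter_ge s1; have yge := powR_three_quarters_ge s1.
set x := (1 / 4) `^ s in eu ev xge *; set y := (3 / 4) `^ s in eu ev yge *.
(* Determinant of the gale equations at [u] and [v] in the unknowns x and y. [xE] and [yE] are
   Cramer's rule; their right sides are positive because x, y and [det] are, so [apx_subc]
   applies. *)
pose det := d (rcons u false) * d (rcons v true) -
  d (rcons v false) * d (rcons u true).
have det0 : 0 < det by rewrite subr_gt0.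
have Det : apx g ins (fun=> det) by apply: apx_subc => //; exact: apx_mul.
have xE : x * det = d u * d (rcons v true) - d v * d (rcons u true).
  by rewrite eu ev /det; ring.
have yE : y * det = d (rcons u false) * d v - d (rcons v false) * d u.
  by rewrite eu ev /det; ring.
have X : apx g ins (fun=> x).
  have -> : (fun=> x) = (fun=> x * det / det) :> (seq (option bool) -> R).
    by apply/funext => _; rewrite mulfK // gt_eqF.
  apply: apx_divc => //; rewrite xE; apply: apx_subc; try exact: apx_mul.
  by rewrite -subr_gt0 -xE mulr_gt0 //; lra.
have Y : apx g ins (fun=> y).
  have -> : (fun=> y) = (fun=> y * det / det) :> (seq (option bool) -> R).
    by apply/funext => _; rewrite mulfK // gt_eqF.
  apply: apx_divc => //; rewrite yE; apply: apx_subc; try exact: apx_mul.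
  by rewrite -subr_gt0 -yE mulr_gt0 //; lra.
have kV : (0 : R) < k%:R^-1 by rewrite invr_gt0 ltr0n.
have T0 : apx g ins (fun=> (1 / 4 : R) `^ k%:R^-1).
  apply: (@apx_root _ _ _ _ k [:: true] [:: false; false; true]) => //.
    by apply: powR_lt1 => //; lra.
  by rewrite powR_root // /ratio /=; lra.
have T1 : apx g ins (fun=> (3 / 8 : R) `^ k%:R^-1).
  apply: (@apx_root _ _ _ _ k [:: true; true]
    [:: false; false; false; true]) => //.
    by apply: powR_lt1 => //; lra.
  by rewrite powR_root // /ratio /=; lra.
have Q4 : apx g ins (fun=> 4 : R).
  rewrite (_ : 4 = ratio R [:: false; false; true] [:: true]); last first.
    by rewrite /ratio /= divr1.
  exact: apx_ratio.
have Q43 : apx g ins (fun=> 4 / 3 : R).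
  rewrite (_ : 4 / 3 = ratio R [:: false; false; true] [:: true; true]) //.
  exact: apx_ratio.
have N0 := fp_zeros_enc F; have N1 := fp_nonzeros_enc F.
have P0 := apx_expc (apx_mul Q4 (apx_mul T0 X)) N0.
have P1 := apx_expc (apx_mul Q43 (apx_mul T1 Y)) N1.
have := apx_mul W (apx_mul P0 P1).
congr apx; apply/funext => w.
by rewrite zeros_encE nonzeros_encE.
Qed.

Theorem theorem6p4 (R : realType) (g : seq bool -> seq bool) :
  (pdim g (beta_distr R) (lang_seq @` NP) < 1)%E ->
  (pdim g (gamma0_distr R) (pair_seq @` disjNP) < 1)%E.
Proof.
move=> /ereal_inf_lt[_ [s [_ [d [gd cd dNP]]] <-]]; rewrite lte_fin => s1.
have succ_d b : succeeds d (fun=> b).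
  have -> : (fun=> b) = lang_seq [set _ | b].
    by apply/funext => n; rewrite /lang_seq asboolb.
  by apply: dNP; exists [set _ | b] => //; exact: NP_const.
have [k k0 [A1 B1]] := lift_exponent s1.
set A := 4 * _ in A1; set B := 4 / 3 * _ in B1.
have kV : (k%:R^-1 : R) <= 1 by rewrite invf_le1 ?ler1n ?ltr0n.
have kV0 : (0 : R) < k%:R^-1 by rewrite invr_gt0 ltr0n.
apply: (@le_lt_trans _ _ (1 - k%:R^-1)%:E); last by rewrite lte_fin; lra.
apply: ereal_inf_lbound; exists (1 - k%:R^-1) => //; split; first lra.
exists (lift_gale d A B); split.
- have q14 : (0 : R) < 1 / 4 by lra.
  have q38 : (0 : R) < 3 / 8 by lra.
  apply: (gale_lift gd); try lra.
    (* The powers with exponents 1 - 1/k and 1/k combine to 1/4, and in the second equation to 3/8;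
       the rational factors 4 and 8/3 cancel these. *)
    transitivity
      (4 * ((1 / 4) `^ (1 - k%:R^-1) * (1 / 4) `^ k%:R^-1) * (1 / 4) `^ s).
      by rewrite /A; ring.
    by rewrite powR_1B //; lra.
  transitivity
    (8 / 3 * ((3 / 8) `^ (1 - k%:R^-1) * (3 / 8) `^ k%:R^-1) * (3 / 4) `^ s).
    by rewrite /B; field.
  by rewrite powR_1B //; lra.
- exact: apx_lift_gale.
- move=> _ [AB [NA NB _] <-]; apply: lift_succeeds; [exact: gd.1|lra|lra|].
  by apply: dNP; exists (AB.1 `|` AB.2) => //; exact: NP_union.
Qed.
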